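(* Assume that $\mathbb{P}_3=\times_{n\in I}q_n$ is such that $q_{n_0}$ is a continuous measure for some $n_0\in I$. Fix sequences $\Lambda=\{\alpha_n\}_{n\in I}\subset\mathbb{R}$ and $R=\{r_n\}_{n\in I}\subset(0,\infty)$. Let $E\in\mathbb{R}$ be fixed, let $P_{\Lambda,R}(E):=\{\Theta\in\Omega_3: E\in\sigma_p(H_{\Lambda,R,\Theta})\}$, and let $B$ be any measurable subset of $P_{\Lambda,R}(E)$. Then $\mathbb{P}_3(B)=0$.
   Context: Let $-\infty\le a<b\le\infty$, $V\in L^1_{\mathrm{loc}}(a,b)$ real-valued, $\tau f:=-f''+Vf$, and let $M=\{x_n\}_{n\in I}\subset(a,b)$, $I\subseteq\mathbb{Z}$, be a fixed discrete set of (distinct) points accumulating at most at $a$ or $b$. For $\Lambda=\{\alpha_n\}_{n\in I}\in\mathbb{R}^I$, $R=\{r_n\}_{n\in I}\in(0,\infty)^I$, $\Theta=\{\theta_n\}_{n\in I}\in\mathbb{R}^I$, set $$A_{\alpha_n,r_n,\theta_n}:=\begin{pmatrix}1&\alpha_n\\0&1\end{pmatrix}\begin{pmatrix}r_n&0\\0&1/r_n\end{pmatrix}\begin{pmatrix}\cos\theta_n&-\sin\theta_n\\ \sin\theta_n&\cos\theta_n\end{pmatrix}.$$ Interface conditions: $(f(x_n+),f'(x_n+))^T=A_{\alpha_n,r_n,\theta_n}(f(x_n-),f'(x_n-))^T$ for all $n\in I$. For $z\in\mathbb{C}$, a solution of $(\tau_{\Lambda,R,\Theta}-z)f=0$ is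 a function $f$ with $f,f'$ (locally) absolutely continuous in $(a,b)\setminus M$, $-f''+Vf-zf=0$, satisfying the interface conditions. $\tau_{\Lambda,R,\Theta}$ is in the limit point case at $a$ (resp. $b$) if for every $z\in\mathbb{C}$ at least one solution of $(\tau_{\Lambda,R,\Theta}-z)f=0$ is not square integrable near $a$ (resp. $b$). It is regular at $a$ if $a$ is finite, $V\in L^1_{\mathrm{loc}}[a,b)$ and $a$ is not an accumulation point of $M$; analogously at $b$. Standing assumption: at $a$, either $\tau_{\Lambda,R,\Theta}$ is regular or it is in the limit point case (for all parameter sequences considered), and likewise at $b$. The selfadjoint operator $H_{\Lambda,R,\Theta}$ in $L^2(a,b)$ acts as $H_{\Lambda,R,\Theta}f=\tau f$ on the domain of all $f\in L^2(a,b)$ such that $f,f'$ are (locally) absolutely continuous in $(a,b)\setminus M$, $-f''+Vf\in L^2(a,b)$, the interface conditions hold, and, at each regular endpoint, a fixed boundary condition holds: $f(a)\cos\psi_a+f'(a)\sin\psi_a=0$ if regular at $a$, and $f(b)\cos\psi_b+f'(b)\sin\psi_b=0$ if regular at $b$, with fixed $\psi_a,\psi_b\in[0,\pi)$ (no condition at a limit point endpoint). $\sigma_p$ denotes the set of eigenvalues. Probability space: $\{q_n\}_{n\in I}$ are probability measures on $\mathbb{R}$ (Borel), and $\Omega_3=(\mathbb{R}^I,\mathcal{F}_3,\mathbb{P}_3)$ with $\mathbb{P}_3=\times_{n\in I}q_n$ the product measure on the product $\sigma$-algebra $\mathcal F_3$ generated by cylinder sets. A measure is continuous if it gives measure zero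 to every single point. *)

(* Defs.v *)
(* Built on MathComp-Analysis: [R] is an arbitrary [realType], complex numbers
   are [R[i]]. *)
From HB Require Import structures.
From mathcomp Require Import all_boot all_order all_algebra finmap.
From mathcomp Require Import complex.
From mathcomp Require Import all_classical all_reals all_analysis.

Set Implicit Arguments.
Unset Strict Implicit.
Unset Printing Implicit Defensive.

Import Order.TTheory GRing.Theory Num.Theory.
Import numFieldNormedType.Exports.

Local Open Scope classical_set_scope.
Local Open Scope ring_scope.
Local Open Scope complex_scope.

Section functions.
Context {R : realType}.

Definition oint (a b : \bar R) : set R := [set t | (a < t%:E < b)%E].

Definition abs_cont (c d : R) (g : R -> R) : Prop :=
  forall e : R, 0 < e -> exists2 delta : R, 0 < delta &
    forall (n : nat) (u v : 'I_n -> R),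
      (forall i, [/\ c <= u i, u i <= v i & v i <= d]) ->
      trivIset [set: 'I_n] (fun i => `]u i, v i[%classic) ->
      \sum_(i < n) (v i - u i) < delta ->
      \sum_(i < n) `|g (v i) - g (u i)| < e.

Definition loc_abs_cont (U : set R) (g : R -> R) : Prop :=
  forall c d : R, c <= d -> `[c, d]%classic `<=` U -> abs_cont c d g.

Definition ReF (f : R -> R[i]) : R -> R := fun t => complex.Re (f t).
Definition ImF (f : R -> R[i]) : R -> R := fun t => complex.Im (f t).

(* Componentwise: [R[i]] carries no topology in the library. *)
Definition clim (f : R -> R[i]) (F : set_system R) (l : R[i]) : Prop :=
  (ReF f t @[t --> F] --> complex.Re l) /\
  (ImF f t @[t --> F] --> complex.Im l).

(* Total, as [derive1] is: meaningful where [f] is differentiable. *)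
Definition cderive (f : R -> R[i]) : R -> R[i] :=
  fun t => derive1 (ReF f) t +i* derive1 (ImF f) t.

Definition cloc_abs_cont (U : set R) (f : R -> R[i]) : Prop :=
  loc_abs_cont U (ReF f) /\ loc_abs_cont U (ImF f).

Definition cdiff_on (U : set R) (f : R -> R[i]) : Prop :=
  forall t, U t -> derivable (ReF f) t 1 /\ derivable (ImF f) t 1.

(* [f] and [f'] locally absolutely continuous; [f'] is then the everywhere
   defined classical derivative on [U], while [f''] exists only a.e. *)
Definition AC1 (U : set R) (f : R -> R[i]) : Prop :=
  [/\ cloc_abs_cont U f, cdiff_on U f & cloc_abs_cont U (cderive f)].

Definition sq_integrable (D : set R) (f : R -> R[i]) : Prop :=
  [/\ measurable_fun D (ReF f), measurable_fun D (ImF f) &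
    (\int[lebesgue_measure]_(t in D) (ReF f t ^+ 2 + ImF f t ^+ 2)%:E < +oo)%E].

(* [L^1_loc(D)] for [D] not necessarily open; [locally_integrable] requires
   an open set. *)
Definition L1loc (D : set R) (V : R -> R) : Prop :=
  measurable_fun D V /\
  forall K, K `<=` D -> compact K ->
    (\int[lebesgue_measure]_(t in K) `|V t|%:E < +oo)%E.

Definition mx2 (m00 m01 m10 m11 : R) : 'M[R]_2 :=
  \matrix_(i, j) (if i == 0 then (if j == 0 then m00 else m01)
                  else (if j == 0 then m10 else m11)).

Definition interface_mx (alpha r theta : R) : 'M[R]_2 :=
  mx2 1 alpha 0 1 *m mx2 r 0 0 r^-1
    *m mx2 (cos theta) (- sin theta) (sin theta) (cos theta).

Definition cV2 (u v : R[i]) : 'cV[R[i]]_2 :=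
  \col_i (if i == 0 then u else v).

End functions.

Section operator.
Context {R : realType} (a b : \bar R) (V : R -> R) (I : set int) (x : I -> R).
Context (Lambda r Theta : I -> R).

Definition interface_points : set R := range x.
Definition regular_set : set R := oint a b `\` interface_points.

Definition tau (f : R -> R[i]) : R -> R[i] :=
  fun t => - cderive (cderive f) t + (V t)%:C * f t.

(* Part of the condition is that the four one-sided limits exist. *)
Definition interface_cond (f : R -> R[i]) : Prop :=
  forall n : I, exists fm f'm fp f'p : R[i],
    [/\ clim f (x n)^'- fm, clim (cderive f) (x n)^'- f'm,
        clim f (x n)^'+ fp, clim (cderive f) (x n)^'+ f'p &
        cV2 fp f'p =
          map_mx (real_complex R) (interface_mx (Lambda n) (r n) (Theta n))
            *m cV2 fm f'm].

Definition solution (z : R[i]) (f : R -> R[i]) : Prop :=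
  [/\ AC1 regular_set f,
      {ae lebesgue_measure, forall t, oint a b t -> tau f t - z * f t = 0} &
      interface_cond f].

Definition sq_integrable_near_left (f : R -> R[i]) : Prop :=
  exists2 c : R, oint a b c & sq_integrable (oint a c%:E) f.

Definition sq_integrable_near_right (f : R -> R[i]) : Prop :=
  exists2 c : R, oint a b c & sq_integrable (oint c%:E b) f.

Definition limit_point_left : Prop :=
  forall z : R[i], exists2 f, solution z f & ~ sq_integrable_near_left f.

Definition limit_point_right : Prop :=
  forall z : R[i], exists2 f, solution z f & ~ sq_integrable_near_right f.

(* [limit_point] is the topological notion (accumulation points). *)
Definition regular_left : Prop :=
  exists a0 : R, [/\ a = a0%:E,
    L1loc [set t | (a <= t%:E < b)%E] V & ~ limit_point interface_points a0].

Definition regular_right : Prop :=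
  exists b0 : R, [/\ b = b0%:E,
    L1loc [set t | (a < t%:E <= b)%E] V & ~ limit_point interface_points b0].

(* At a regular endpoint the boundary values are the one-sided limits. *)
Definition bc_left (psi : R) (f : R -> R[i]) : Prop :=
  exists fa f'a : R[i],
    [/\ clim f (fine a)^'+ fa,
        clim (cderive f) (fine a)^'+ f'a &
        fa * (cos psi)%:C + f'a * (sin psi)%:C = 0].

Definition bc_right (psi : R) (f : R -> R[i]) : Prop :=
  exists fb f'b : R[i],
    [/\ clim f (fine b)^'- fb,
        clim (cderive f) (fine b)^'- f'b &
        fb * (cos psi)%:C + f'b * (sin psi)%:C = 0].

(* The operator [H] acts as [tau] on the following domain. *)
Definition domH (psi_a psi_b : R) (f : R -> R[i]) : Prop :=
  [/\ sq_integrable (oint a b) f,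
      AC1 regular_set f,
      sq_integrable (oint a b) (tau f),
      interface_cond f &
      (regular_left -> bc_left psi_a f) /\
      (regular_right -> bc_right psi_b f)].

(* Eigenvalues of [H]; elements of [L^2(a,b)] are identified when equal a.e. *)
Definition point_spectrumH (psi_a psi_b : R) : set R[i] :=
  [set z | exists f : R -> R[i],
    [/\ domH psi_a psi_b f,
        ~ {ae lebesgue_measure, forall t, oint a b t -> f t = 0} &
        {ae lebesgue_measure, forall t, oint a b t -> tau f t = z * f t}]].

End operator.

Section product_space.
Context {R : realType} (I : set int).

Definition cylinder (J : {fset I}) (A : I -> set R) : set (I -> R) :=
  [set Theta | forall n, n \in J -> A n (Theta n)].

Definition cylinders : set (set (I -> R)) :=
  [set C | exists (J : {fset I}) (A : I -> set R),
     (forall n, measurable (A n)) /\ C = cylinder J A].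

Definition Omega3 := g_sigma_algebraType cylinders.

(* [P] is the product of the [q n]: the unique probability measure on the
   product sigma-algebra with these values on cylinder sets. *)
Definition is_product_measure (q : I -> probability (measurableTypeR R) R)
    (P : probability Omega3 R) : Prop :=
  forall (J : {fset I}) (A : I -> set R), (forall n, measurable (A n)) ->
    P (cylinder J A) = (\prod_(n <- J) q n (A n))%E.

End product_space.
Arguments Omega3 R I : clear implicits.

Definition continuous_measure {R : realType}
    (q : probability (measurableTypeR R) R) : Prop :=
  forall y : R, q [set y] = 0%E.

(* Main.v *)
Require Import Defs.
From HB Require Import structures.
From mathcomp Require Import all_boot all_order all_algebra finmap.
From mathcomp Require Import complex.
From mathcomp Require Import all_classical all_reals all_analysis.
From mathcomp Require Import measurable_realfun.
From mathcomp Require Import ring lra.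

(** Fix all the angles except [Theta n0]. The theorem holds because the values of
    [Theta n0] for which [E] is an eigenvalue agree modulo [pi], hence form a
    countable set, which is null for the continuous measure [q n0]; integrating
    over the other coordinates ([product_measure_resample]) gives [P3 B = 0].

    For the claim on angles ([eigenvalue_angles]), take eigenfunctions [u] and
    [v] for two angle sequences that differ only at [n0]. As [V], [E] and the
    interface matrices are real, [u] and [v] can be taken real
    ([eigenvalue_real_eigenfunction]). On each side of [x n0] both solve the same
    equation with the same interface conditions, and these matrices have
    determinant 1, so the Wronskian of [u] and [v] is constant there
    ([wronskian_everywhere]). The constant is zero ([left_wronskian0],
    [right_wronskian0]): at a regular endpoint by the common boundary condition;
    at a limit point endpoint because otherwise every solution would be a
    combination of the square integrable functions [u] and [v]. Hence the left
    Cauchy data of [u] and [v] at [x n0] are proportional, and so are the right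
    ones. They are nonzero by unique continuation ([energy0_of_left_limit]), so
    the rotation by the difference of the two angles fixes a real direction,
    which means that the sine of this difference vanishes
    ([interface_rotation]). Reality matters here, since a rotation has complex
    eigenvectors that do not depend on its angle.

    Constancy of the Wronskian and unique continuation rest on the fundamental
    theorem of calculus for absolutely continuous functions ([abs_cont_FTC]).
    Such a function is a difference of two nondecreasing absolutely continuous
    functions built from its total variation, the Stieltjes measures of these
    have Radon-Nikodym densities, and Lebesgue differentiation recovers the
    derivative. Unique continuation is Gronwall's inequality for [u^2 + u'^2] on
    segments over which [|1 + V - E|] has small integral
    ([energy_segment_comparable]). Both local facts become global through
    [locally_cst_is_cst], interface points included. *)

Set Implicit Arguments.
Unset Strict Implicit.
Unset Printing Implicit Defensive.
Import Order.TTheory GRing.Theory Num.Theory.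
Import numFieldNormedType.Exports.
Local Open Scope classical_set_scope.
Local Open Scope ring_scope.
Local Open Scope complex_scope.

(** * Absolutely continuous functions and their total variation *)

Section ac_variation.
Context {R : realType}.
Implicit Types (c d : R) (g : R -> R).
Notation TV := total_variation.

(** Absolute continuity is stated with families indexed by ['I_n]; any finite
    index type will do, in particular the dependent pairs used below. *)
Lemma abs_cont_fin c d g : abs_cont c d g ->
  forall e : R, 0 < e -> exists2 delta : R, 0 < delta &
    forall (J : finType) (u v : J -> R),
      (forall i, [/\ c <= u i, u i <= v i & v i <= d]) ->
      trivIset [set: J] (fun i => `]u i, v i[%classic) ->
      \sum_(i : J) (v i - u i) < delta ->
      \sum_(i : J) `|g (v i) - g (u i)| < e.
Proof.
move=> gac e /gac[delta d0 H]; exists delta => // J u v uv tr.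
have sumE (F : J -> R) : \sum_(i : J) F i = \sum_(k < #|J|) F (enum_val k).
  by rewrite (reindex _ (onW_bij _ (enum_val_bij J))).
rewrite !sumE => suv; have := H #|J| (u \o enum_val) (v \o enum_val); apply => //.
- by move=> i; exact: uv.
- apply/trivIsetP => i j _ _ ij /=.
  move/trivIsetP : tr; apply => //.
  by apply: contra ij => /eqP/enum_val_inj ->.
Qed.

(** The variations of [g] along arbitrary partitions of short disjoint intervals
    are jointly small: the pieces of all the partitions form one family of
    disjoint intervals of the same total length. *)
Lemma abs_cont_variation c d g : abs_cont c d g ->
  forall e : R, 0 < e -> exists2 delta : R, 0 < delta &
    forall (n : nat) (u v : 'I_n -> R) (s : 'I_n -> seq R),
      (forall i, [/\ c <= u i, u i <= v i & v i <= d]) ->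
      trivIset [set: 'I_n] (fun i => `]u i, v i[%classic) ->
      (forall i, itv_partition (u i) (v i) (s i)) ->
      \sum_(i < n) (v i - u i) < delta ->
      \sum_(i < n) variation (u i) (v i) g (s i) < e.
Proof.
move=> gac e e0; have [delta d0 H] := abs_cont_fin gac e0.
exists delta => // n u v s uv tr ps suv.
pose J := {i : 'I_n & 'I_(size (s i))}.
(* [U j] and [W j] are the endpoints of the [j]-th piece; entry 0 of the
   sequence [u i :: s i] is the left endpoint [u i]. *)
pose U (j : J) := nth (v (tag j)) (u (tag j) :: s (tag j)) (tagged j).
pose W (j : J) := nth (v (tag j)) (u (tag j) :: s (tag j)) (tagged j).+1.
have sumE (F : R -> R -> R) :
    \sum_(j : J) F (W j) (U j) = \sum_(i < n) \sum_(0 <= k < size (s i))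
      F (nth (v i) (u i :: s i) k.+1) (nth (v i) (u i :: s i) k).
  transitivity (\sum_(i < n) \sum_(k < size (s i))
      F (nth (v i) (u i :: s i) k.+1) (nth (v i) (u i :: s i) k)).
    by rewrite sig_big_dep.
  by apply: eq_bigr => i _; rewrite big_mkord.
have inc i (k l : nat) : (k <= l)%N -> (l <= size (s i))%N ->
    nth (v i) (u i :: s i) k <= nth (v i) (u i :: s i) l.
  move=> kl ls; have [su _] := ps i.
  move: kl; rewrite leq_eqVlt => /predU1P[->//|kl].
  apply/ltW.
  have /(_ k l) := @sorted_ltn_nth _ <%O lt_trans (v i) (u i :: s i) su.
  by apply => //; rewrite inE /= ltnS // (leq_trans (ltnW kl)).
have Ub j : u (tag j) <= U j.
  apply: itv_partition_nth_ge (ps _).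
  by rewrite ltnS ltnW.
have Wb j : W j <= v (tag j).
  by apply: itv_partition_nth_le (ps _); rewrite ltnS.
have -> : \sum_(i < n) variation (u i) (v i) g (s i) =
          \sum_(j : J) `|g (W j) - g (U j)|.
  by rewrite (sumE (fun x y => `|g x - g y|)).
apply: H.
- move=> j; have [? ? ?] := uv (tag j); split.
  + exact: le_trans (Ub j).
  + by apply: inc.
  + exact: le_trans (Wb j) _.
- apply/trivIsetP => -[i k] [i' k'] _ _ /= ii'.
  have [E|ii''] := eqVneq i i'; last first.
    move/trivIsetP : tr => /(_ i i' Logic.I Logic.I ii'').
    apply: subsetI_eq0 => y /=; rewrite !in_itv/= => /andP[h1 h2].
      rewrite (le_lt_trans (Ub (existT _ i k)))//=.
      exact: lt_le_trans h2 (Wb (existT _ i k)).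
    rewrite (le_lt_trans (Ub (existT _ i' k')))//=.
    exact: lt_le_trans h2 (Wb (existT _ i' k')).
  subst i'.
  wlog kk' : k k' {ii'} / (k < k')%N.
    move=> W'; have [kk'|kk'|kk'] := ltngtP k k'; first exact: W'.
      by rewrite setIC; exact: W'.
    by move: ii' => /negP; case; apply/eqP; congr existT; exact: val_inj.
  apply/seteqP; split => // y [/=]; rewrite !in_itv/= => /andP[_ h1] /andP[h2 _].
  have := inc i k.+1 k' kk' (ltnW (ltn_ord k')).
  by rewrite /U /W/= in h1 h2 *; move=> h3; lra.
- rewrite (sumE (fun x y => x - y)).
  rewrite (le_lt_trans _ suv)// ler_sum// => i _.
  rewrite telescope_sumr//.
  by rewrite (itv_partition_nth_size _ (ps i)).
Qed.

Lemma abs_cont_sub c d c' d' g : c <= c' -> d' <= d ->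
  abs_cont c d g -> abs_cont c' d' g.
Proof.
move=> cc dd H e /H[delta d0 {}H]; exists delta => // n u v uv.
apply: H => i; have [? ? ?] := uv i; split => //.
  exact: le_trans cc _.
exact: le_trans dd.
Qed.

Lemma abs_cont1 c d g : abs_cont c d g -> forall e : R, 0 < e ->
  exists2 delta : R, 0 < delta & forall u v, c <= u -> u <= v -> v <= d ->
   v - u < delta -> `|g v - g u| < e.
Proof.
move=> gac e /gac[delta d0 H]; exists delta => // u v cu uv vd vu.
have := H 1%N (fun=> u) (fun=> v); rewrite !big_ord1; apply => //.
by apply/trivIsetP => i j _ _; rewrite !ord1 eqxx.
Qed.

Lemma abs_cont_BV_small c d g : abs_cont c d g ->
  exists2 delta : R, 0 < delta & forall u v, c <= u -> u <= v -> v <= d ->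
   v - u < delta -> (TV u v g <= 1)%E.
Proof.
move=> gac; have [delta d0 H] := abs_cont_variation gac (@ltr01 R).
exists delta => // u v cu uv vd vu.
apply: ub_ereal_sup => _ [_ [s su <-] <-].
have := H 1%N (fun=> u) (fun=> v) (fun=> s).
rewrite !big_ord1 lee_fin => h; apply/ltW/h => //.
by apply/trivIsetP => i j _ _; rewrite !ord1 eqxx.
Qed.

(** [g] has bounded variation: the interval is covered by steps of length half
    of a [delta] for which the variation is at most 1, and variation is additive. *)
Lemma abs_cont_TV_fin c d g t : abs_cont c d g -> c <= t -> t <= d ->
  TV c t g \is a fin_num.
Proof.
move=> gac ct td; have [delta d0 H] := abs_cont_BV_small gac.
have H1 n : forall t, c <= t -> t <= d -> t - c <= n%:R * (delta / 2) ->
    TV c t g \is a fin_num.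
  elim: n => [|n IH] y cy yd.
    rewrite mul0r => yc; have -> : y = c by apply/eqP; rewrite eq_le cy; lra.
    by rewrite total_variationxx.
  rewrite -natr1 mulrDl mul1r => yn.
  have [yc|yc] := leP (y - delta / 2) c.
    rewrite ge0_fin_numE ?total_variation_ge0//.
    by rewrite (le_lt_trans (H _ _ _ _ _ _)) ?ltry//; lra.
  rewrite (@total_variationD _ _ _ (y - delta / 2)) //; [|lra..].
  rewrite fin_numD IH/=; [|lra..].
  rewrite ge0_fin_numE ?total_variation_ge0//; [|lra].
  by rewrite (le_lt_trans (H _ _ _ _ _ _)) ?ltry//; lra.
pose n := (Num.bound ((t - c) / (delta / 2))).
apply: (H1 n) => //.
rewrite -ler_pdivrMr ?divr_gt0//.
by apply/ltW/archi_boundP; rewrite divr_ge0 ?subr_ge0// ltW// divr_gt0.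
Qed.

(** The total variation function inherits absolute continuity: up to [e / 2] each
    total variation is realised by a partition, to which
    [abs_cont_variation] applies. *)
Lemma abs_cont_TV c d g : c <= d -> abs_cont c d g ->
  abs_cont c d (fun t => fine (TV c t g)).
Proof.
move=> cd gac e e0.
have [delta d0 H] := abs_cont_variation gac (divr_gt0 e0 (ltr0n _ 2)).
exists delta => // n u v uv tr suv.
have TVE i : `|fine (TV c (v i) g) - fine (TV c (u i) g)| = fine (TV (u i) (v i) g).
  have [cu ui vd] := uv i; have cv := le_trans cu ui.
  have := abs_cont_TV_fin gac cv vd.
  rewrite (total_variationD g cu ui) fin_numD => /andP[f1 f2].
  by rewrite fineD// addrAC subrr add0r ger0_norm// fine_ge0// total_variation_ge0.
rewrite (eq_bigr _ (fun i _ => TVE i)).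
case: n => [|n] in u v uv tr suv TVE *; first by rewrite big_ord0.
(* the errors of the [n.+1] partitions add up to [e / 2] *)
pose eta := e / 2 / n.+1%:R.
have eta0 : 0 < eta by rewrite !divr_gt0.
have sP i : exists s, itv_partition (u i) (v i) s /\
    fine (TV (u i) (v i) g) < variation (u i) (v i) g s + eta.
  have [cu ui vd] := uv i.
  have fin : TV (u i) (v i) g \is a fin_num.
    exact: (abs_cont_TV_fin (abs_cont_sub cu (lexx d) gac)).
  have [_ [_ [s su <-] <-] h] := ub_ereal_sup_adherent eta0 fin.
  exists s; split => //; rewrite -ltrBlDr -lte_fin EFinB fineK//.
have [s sP'] := choice sP.
have h := H _ u v s uv tr (fun i => (sP' i).1) suv.
have : \sum_(i < n.+1) fine (TV (u i) (v i) g) <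
    \sum_(i < n.+1) (variation (u i) (v i) g (s i) + eta).
  apply: ltr_sum => [|i _]; last exact: (sP' i).2.
  by apply/hasP; exists ord0 => //; rewrite mem_index_enum.
rewrite big_split/= sumr_const card_ord -mulr_natr /eta divfK ?pnatr_eq0// -/eta.
lra.
Qed.

Lemma abs_contD c d f g : abs_cont c d f -> abs_cont c d g ->
  abs_cont c d (fun t => f t + g t).
Proof.
move=> fa ga e e0; have e20 := divr_gt0 e0 (ltr0n _ 2).
have [d1 d10 H1] := fa _ e20; have [d2 d20 H2] := ga _ e20.
exists (Num.min d1 d2); first by rewrite lt_min d10.
move=> n u v uv tr; rewrite lt_min => /andP[s1 s2].
have h1 := H1 _ _ _ uv tr s1; have h2 := H2 _ _ _ uv tr s2.
apply: (@le_lt_trans _ _ (\sum_(i < n) (`|f (v i) - f (u i)| + `|g (v i) - g (u i)|))).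
  apply: ler_sum => i _; rewrite opprD addrACA; exact: ler_normD.
by rewrite big_split/=; lra.
Qed.

Lemma abs_cont_bounded c d g : abs_cont c d g ->
  exists2 M : R, 0 < M & forall t, c <= t <= d -> `|g t| <= M.
Proof.
move=> gac; have [dc|cd] := ltP d c.
  by exists 1 => // t /andP[ct td]; have := lt_le_trans dc (le_trans ct td); rewrite ltxx.
exists (`|g c| + fine (TV c d g) + 1).
  by rewrite ltr_wpDl// addr_ge0// fine_ge0// total_variation_ge0.
move=> t /andP[ct td].
have h : `|g t - g c| <= fine (TV c d g).
  rewrite -lee_fin fineK ?(abs_cont_TV_fin gac)// (total_variationD g ct td).
  by rewrite (le_trans (total_variation_ge _ ct))// leeDl// total_variation_ge0.
have := ler_normD (g t - g c) (g c); rewrite subrK; lra.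
Qed.

Lemma abs_contM c d f g : abs_cont c d f -> abs_cont c d g ->
  abs_cont c d (fun t => f t * g t).
Proof.
move=> fa ga e e0.
have [M M0 MP] := abs_cont_bounded fa; have [N N0 NP] := abs_cont_bounded ga.
have [d1 d10 H1] := fa _ (divr_gt0 e0 (mulr_gt0 (ltr0n _ 2) N0)).
have [d2 d20 H2] := ga _ (divr_gt0 e0 (mulr_gt0 (ltr0n _ 2) M0)).
exists (Num.min d1 d2); first by rewrite lt_min d10.
move=> n u v uv tr; rewrite lt_min => /andP[s1 s2].
have h1 := H1 _ _ _ uv tr s1; have h2 := H2 _ _ _ uv tr s2.
rewrite ltr_pdivlMr ?mulr_gt0// in h1; rewrite ltr_pdivlMr ?mulr_gt0// in h2.
apply: (@le_lt_trans _ _ (\sum_(i < n)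
    (`|f (v i) - f (u i)| * N + `|g (v i) - g (u i)| * M))).
  apply: ler_sum => i _; have [cu ui vd] := uv i.
  have -> : f (v i) * g (v i) - f (u i) * g (u i) =
    (f (v i) - f (u i)) * g (v i) + (g (v i) - g (u i)) * f (u i) by ring.
  rewrite (le_trans (ler_normD _ _))// !normrM lerD// ler_wpM2l//.
    by apply: NP; rewrite (le_trans cu ui).
  by apply: MP; rewrite cu (le_trans ui vd).
rewrite big_split/= -!mulr_suml; lra.
Qed.

Lemma abs_contN c d f : abs_cont c d f -> abs_cont c d (fun t => - f t).
Proof.
move=> fa e /fa[delta d0 H]; exists delta => // n u v uv tr s.
rewrite (eq_bigr (fun i => `|f (v i) - f (u i)|)) ?H// => i _.
by rewrite -opprD normrN.
Qed.

End ac_variation.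

(** * Density of an absolutely continuous function *)

Section ac_density.
Context {R : realType}.
Implicit Types (c d : R) (g : R -> R).
Notation mu := (@lebesgue_measure R).

(** The retraction of the line onto [[c, d]] (for [c <= d]); composing with it
    extends a function from [[c, d]] by constants. *)
Definition clamp c d (t : R) : R := Num.max c (Num.min t d).

Lemma clamp_in c d t : c <= d -> c <= clamp c d t <= d.
Proof. by move=> cd; rewrite /clamp le_max lexx/= ge_max cd ge_min lexx orbT. Qed.

Lemma clamp_id c d t : c <= t <= d -> clamp c d t = t.
Proof. by move=> /andP[ct td]; rewrite /clamp min_l// max_r. Qed.

Lemma clamp_le c d s t : s <= t -> clamp c d s <= clamp c d t.
Proof.
move=> st; rewrite /clamp ge_max le_max lexx/= le_max; apply/orP; right.
by rewrite le_min ge_min st/= ge_min lexx orbT.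
Qed.

Lemma clamp_dist c d s t : s <= t -> clamp c d t - clamp c d s <= t - s.
Proof.
move=> st; rewrite /clamp.
have [h1|h1] := leP s d; have [h2|h2] := leP t d.
- rewrite [X in X - _]maxEle [X in _ - X]maxEle.
  by case: (leP c t); case: (leP c s) => *; lra.
- rewrite [X in X - _]maxEle [X in _ - X]maxEle.
  by case: (leP c d); case: (leP c s) => *; lra.
- lra.
- lra.
Qed.

Lemma lebesgue_stieltjes_itvoc (F : cumulative R R) (s t : R) : s <= t ->
  lebesgue_stieltjes_measure F `]s, t]%classic = (F t - F s)%:E.
Proof.
move=> st; rewrite /lebesgue_stieltjes_measure /= /measure_extension.
rewrite measurable_mu_extE/=; last exact: is_ocitv.
rewrite wlength_itv/= lte_fin; case: ltP => // ts.
have -> : s = t by apply/le_anti; rewrite st.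
by rewrite subrr.
Qed.

Lemma open_interval_bounded (J : set R) : open J -> is_interval J ->
  has_lbound J -> has_ubound J -> J = `]inf J, sup J[%classic.
Proof.
move=> oJ iJ lJ uJ; rewrite -interval_bounded_interior//.
by apply/esym/interior_id.
Qed.

(** The Stieltjes measure of an absolutely continuous nondecreasing function is
    absolutely continuous with respect to Lebesgue measure: a null set lies in
    an open set of small measure, which is a countable disjoint union of open
    intervals. *)
Lemma abs_cont_stieltjes_null (F : cumulative R R) c d : c <= d ->
  (forall t, F t = F (clamp c d t)) -> abs_cont c d F ->
  forall A, measurable A -> A `<=` `]c, d]%classic -> mu A = 0%E ->
  lebesgue_stieltjes_measure F A = 0%E.
Proof.
move=> cd Fc Fac A mA Acd A0.
apply/eqP; rewrite eq_le measure_ge0 andbT; apply/lee_addgt0Pr => e e0.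
rewrite add0e; have [delta d0 H] := Fac _ e0.
have Aoo : (mu A < +oo)%E by rewrite A0.
have [U0 [oU0 AU0 U0d]] := lebesgue_regularity_outer mA Aoo d0.
(* intersecting with a bounded interval makes the components bounded *)
have oU : open (U0 `&` `]c - 1, d + 1[%classic).
  by apply: openI => //; exact: interval_open.
set U := U0 `&` _ in oU.
have AU : A `<=` U.
  move=> y Ay; split; first exact: AU0.
  by have := Acd _ Ay; rewrite /= !in_itv/= => /andP[]; lra.
have mU : measurable U by exact: open_measurable.
have Ud : (mu U < delta%:E)%E.
  rewrite (le_lt_trans _ U0d)//.
  apply: (@le_trans _ _ (mu U0)).
    by apply: le_measure; rewrite ?inE//; [exact: open_measurable|move=> y []].
  have mU0 : measurable U0 by exact: open_measurable.
  have mD : measurable (U0 `\` A) by exact: measurableD.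
  rewrite -[X in (mu X <= _)%E](setDUK AU0).
  apply: (le_trans (measureU2 mu mA mD)).
  by rewrite [X in (X + _)%E](_ : _ = 0%E) ?add0e.
pose J := open_disjoint_itv oU.
have mJ k : measurable (J k).
  by apply: open_measurable; exact: open_disjoint_itv_open.
have UJ : U = \bigcup_k J k := open_disjoint_itv_bigcup oU.
have JU k : J k `<=` U by rewrite UJ; exact: bigcup_sup.
have tJ : trivIset setT J := @open_disjoint_itv_trivIset _ _ oU.
have JE0 k : exists ab : R * R, ab.1 <= ab.2 /\ J k = `]ab.1, ab.2[%classic.
  have [J0|/set0P[y Jy]] := eqVneq (J k) set0.
    by exists (c, c); split => //=; rewrite J0; apply/seteqP; split => // z /=;
      rewrite in_itv/= => /andP[]; lra.
  have lJ : has_lbound (J k).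
    by exists (c - 1) => z /JU[_]; rewrite /= in_itv/= => /andP[/ltW].
  have uJ : has_ubound (J k).
    by exists (d + 1) => z /JU[_]; rewrite /= in_itv/= => /andP[_ /ltW].
  exists (inf (J k), sup (J k)); split => /=.
    by apply: (@le_trans _ _ y); [exact: ge_inf|exact: ub_le_sup].
  apply: open_interval_bounded => //; first exact: open_disjoint_itv_open.
  exact: open_disjoint_itv_is_interval.
have [pq pqP] := choice JE0.
pose p k := (pq k).1; pose q k := (pq k).2.
have pqk k : p k <= q k by have [] := pqP k.
have JE k : J k = `]p k, q k[%classic by have [] := pqP k.
have LS k : (lebesgue_stieltjes_measure F (J k) <= (F (q k) - F (p k))%:E)%E.
  rewrite -lebesgue_stieltjes_itvoc//; apply: le_measure; rewrite ?inE.
  - exact: mJ.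
  - exact: measurable_itv.
  - by rewrite JE; apply: subset_itvl; rewrite bnd_simp.
apply: (@le_trans _ _ (lebesgue_stieltjes_measure F U)).
  by apply: le_measure; rewrite ?inE.
have -> : lebesgue_stieltjes_measure F U =
    (\sum_(0 <= k <oo) lebesgue_stieltjes_measure F (J k))%E.
  rewrite UJ measure_bigcup.
  - by apply: eq_eseriesl => k; rewrite in_setT.
  - by move=> k _; exact: mJ.
  - exact: tJ.
apply: lime_le; first by apply: is_cvg_nneseries.
near=> n; rewrite big_mkord.
apply: (@le_trans _ _ (\sum_(i < n) (F (q i) - F (p i)))%:E).
  by rewrite -sumEFin; apply: lee_sum => i _; exact: LS.
rewrite lee_fin; apply/ltW.
apply: le_lt_trans (H n (fun i => clamp c d (p i)) (fun i => clamp c d (q i)) _ _ _).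
- by apply: ler_sum => i _; rewrite -!Fc; exact: ler_norm.
- move=> i; have /andP[? _] := clamp_in (p i) cd.
  by have /andP[_ ?] := clamp_in (q i) cd; split => //; exact: clamp_le.
- apply/trivIsetP => i j _ _ ij.
  have /trivIsetP/(_ _ _ Logic.I Logic.I ij) := tJ.
  apply: subsetI_eq0 => y; rewrite JE /= !in_itv/=.
    rewrite /clamp gt_max lt_max lt_min gt_min; lra.
  rewrite /clamp gt_max lt_max lt_min gt_min; lra.
- apply: (@le_lt_trans _ _ (\sum_(i < n) (q i - p i))).
    by apply: ler_sum => i _; exact: clamp_dist.
  rewrite -lte_fin (le_lt_trans _ Ud)// -sumEFin.
  rewrite (eq_bigr (fun i : 'I_n => mu (J i))); last first.
    move=> i _; rewrite JE lebesgue_measure_itv/= lte_fin; case: ltP => // h.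
    have -> : q i = p i by apply/le_anti; rewrite pqk h.
    by rewrite subrr.
  rewrite -(big_mkord xpredT (fun i => mu (J i))).
  have -> : mu U = (\sum_(0 <= k <oo) mu (J k))%E.
    rewrite UJ measure_bigcup.
    - by apply: eq_eseriesl => k; rewrite in_setT.
    - by move=> k _; exact: mJ.
    - exact: tJ.
  exact: nneseries_lim_ge.
Unshelve. all: by end_near. Qed.

Lemma abs_cont_clamp_cvg c d g x : c <= d -> abs_cont c d g ->
  g (clamp c d t) @[t --> x^'+] --> g (clamp c d x).
Proof.
move=> cd gac; apply/cvgrPdist_lt => e e0.
have [delta d0 H] := abs_cont1 gac e0.
near=> t; rewrite distrC; apply: H.
- by have /andP[] := clamp_in x cd.
- by apply: clamp_le; near: t; exact: nbhs_right_ge.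
- by have /andP[] := clamp_in t cd.
- apply: (@le_lt_trans _ _ (t - x)).
    by apply: clamp_dist; near: t; exact: nbhs_right_ge.
  by rewrite ltrBlDl; near: t; apply: nbhs_right_lt; rewrite ltrDl.
Unshelve. all: by end_near. Qed.

(** Radon-Nikodym theorem applied to the Stieltjes measure of the extension of
    [g] by constants, restricted to [[c, d]]. *)
Lemma abs_cont_nondecreasing_density c d g : c <= d -> abs_cont c d g ->
  (forall s t, c <= s -> s <= t -> t <= d -> g s <= g t) ->
  exists h : R -> R, mu.-integrable setT (EFin \o h) /\
    forall s t, c <= s -> s <= t -> t <= d ->
      (g t - g s)%:E = (\int[mu]_(x in `]s, t]) (h x)%:E)%E.
Proof.
move=> cd gac gnd; pose G t := g (clamp c d t).
have Gnd : nondecreasing G.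
  move=> s t st; have /andP[? _] := clamp_in s cd; have /andP[_ ?] := clamp_in t cd.
  by apply: gnd => //; exact: clamp_le.
have Grc : right_continuous G by move=> x; exact: abs_cont_clamp_cvg.
pose F : cumulative R R := HB.pack G (isCumulative.Build R _ R G Gnd Grc).
have FG s : c <= s -> s <= d -> F s = g s by move=> cs sd; rewrite /= /G clamp_id// cs.
have Fac : abs_cont c d F.
  move=> e /gac[delta d0 H]; exists delta => // n u v uv tr suv.
  rewrite (eq_bigr (fun i => `|g (v i) - g (u i)|)) ?H// => i _.
  have [cu ui vd] := uv i.
  by rewrite !FG ?(le_trans cu ui) ?(le_trans ui vd).
have Fc t : F t = F (clamp c d t) by rewrite /= /G [in RHS]clamp_id// clamp_in.
have mE : measurable (`]c, d]%classic : set (measurableTypeR R)) by exact: measurable_itv.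
have fE : (lebesgue_stieltjes_measure F `]c, d]%classic < +oo)%E.
  by rewrite lebesgue_stieltjes_itvoc// ltry.
pose nu : {finite_measure set (measurableTypeR R) -> \bar R} := mfrestr mE fE.
have numu : nu `<< mu.
  apply/null_content_dominatesP => A mA A0.
  apply: (abs_cont_stieltjes_null cd Fc Fac).
  - exact: measurableI.
  - by move=> y [].
  - apply/eqP; rewrite -measure_le0 -A0; apply: le_measure; rewrite ?inE//.
    exact: measurableI.
have [f [f0 ffin fint fE']] := radon_nikodym_sigma_finite numu.
exists (fine \o f); split.
  by apply: eq_integrable fint => // x _; rewrite /= fineK.
move=> s t cs st td; transitivity (nu `]s, t]%classic).
  rewrite /nu /= /mfrestr /mrestr setIidl.
    by rewrite lebesgue_stieltjes_itvoc// !FG// ?(le_trans cs)// (le_trans st).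
  by apply: subset_itv; rewrite bnd_simp.
rewrite fE'; last exact: measurable_itv.
by apply: eq_integral => x _; rewrite /= fineK.
Qed.

(** A general [g] is the difference of its total variation [T] and of the
    nondecreasing function [T - g]. *)
Lemma abs_cont_density c d g : c <= d -> abs_cont c d g ->
  exists h : R -> R, mu.-integrable setT (EFin \o h) /\
    forall s t, c <= s -> s <= t -> t <= d ->
      (g t - g s)%:E = (\int[mu]_(x in `]s, t]) (h x)%:E)%E.
Proof.
move=> cd gac.
have Tac := abs_cont_TV cd gac; set T := fun t => fine _ in Tac.
have fin s : c <= s -> s <= d -> total_variation c s g \is a fin_num.
  exact: abs_cont_TV_fin.
have TD s t : c <= s -> s <= t -> t <= d -> `|g t - g s| <= T t - T s.
  move=> cs st td; rewrite /T (total_variationD g cs st).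
  have := fin _ (le_trans cs st) td.
  rewrite (total_variationD g cs st) fin_numD => /andP[f1 f2].
  rewrite fineD// addrAC subrr add0r -lee_fin fineK//.
  exact: total_variation_ge.
have [h1 [ih1 h1E]] : exists h : R -> R, mu.-integrable setT (EFin \o h) /\
    forall s t, c <= s -> s <= t -> t <= d ->
      (T t - T s)%:E = (\int[mu]_(x in `]s, t]) (h x)%:E)%E.
  apply: abs_cont_nondecreasing_density => // s t cs st td.
  by rewrite -subr_ge0; apply: le_trans (TD _ _ cs st td).
have [h2 [ih2 h2E]] : exists h : R -> R, mu.-integrable setT (EFin \o h) /\
    forall s t, c <= s -> s <= t -> t <= d ->
      ((T t + - g t) - (T s + - g s))%:E = (\int[mu]_(x in `]s, t]) (h x)%:E)%E.
  apply: (@abs_cont_nondecreasing_density _ _ (fun t => T t + - g t)) => //.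
    by apply: abs_contD => //; exact: abs_contN.
  move=> s t cs st td; have := TD _ _ cs st td.
  have := ler_norm (g t - g s); lra.
exists (h1 \- h2); split.
  by apply: eq_integrable (integrableB measurableT ih1 ih2) => //.
move=> s t cs st td.
have mst : measurable (`]s, t]%classic : set R) by exact: measurable_itv.
transitivity (\int[mu]_(x in `]s, t]) ((h1 x)%:E - (h2 x)%:E))%E; last first.
  by apply: eq_integral => x _; rewrite EFinB.
rewrite integralB//; [|exact: (integrableS measurableT)..].
by rewrite -h1E// -h2E// -EFinB; congr EFin; ring.
Qed.

End ac_density.

(** * Fundamental theorem of calculus for absolutely continuous functions *)

Section ac_ftc.
Context {R : realType}.
Implicit Types (c d : R) (g : R -> R).
Notation mu := (@lebesgue_measure R).

Lemma ae_impl (P Q : R -> Prop) : (forall x, P x -> Q x) ->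
  {ae mu, forall x, P x} -> {ae mu, forall x, Q x}.
Proof. by apply: filterS; exact: (ae_filter_ringOfSetsType mu). Qed.

Lemma ae_impl2 (P Q S : R -> Prop) : (forall x, P x -> Q x -> S x) ->
  {ae mu, forall x, P x} -> {ae mu, forall x, Q x} -> {ae mu, forall x, S x}.
Proof. by apply: filterS2; exact: (ae_filter_ringOfSetsType mu). Qed.

(** An absolutely continuous function is almost everywhere differentiable and is
    the integral of its derivative; [h] is a density of [g], and Lebesgue
    differentiation identifies it with the derivative. *)
Lemma abs_cont_FTC c d g : c <= d -> abs_cont c d g ->
  exists h : R -> R, [/\ mu.-integrable setT (EFin \o h),
    (forall s t, c <= s -> s <= t -> t <= d ->
      g t - g s = \int[mu]_(x in `]s, t]) h x) &
    {ae mu, forall x, c < x < d -> derivable g x 1 /\ derive1 g x = h x}].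
Proof.
move=> cd gac; have [h [ih hE]] := abs_cont_density cd gac.
have hE' s t : c <= s -> s <= t -> t <= d ->
    g t - g s = \int[mu]_(x in `]s, t]) h x.
  by move=> cs st td; rewrite /Rintegral -hE.
exists h; split => //.
have ihy (A : set R) : measurable A -> mu.-integrable A (EFin \o h).
  by move=> mA; exact: (integrableS measurableT).
have lh : locally_integrable setT h.
  by apply: open_integrable_locally => //; exact: openT.
have := FTC1Ny (fun y => ihy _ (measurable_itv _)) lh.
apply: ae_impl => x /= [dF F'] /andP[cx xd].
set F := fun x => _ in dF F'.
(* near [x], [g] and the primitive [F] differ by a constant *)
have gF : \near x, F x + (g c - F c) = g x.
  near=> y.
  have cy : c <= y by apply/ltW; near: y; exact: lt_nbhsr.
  have yd : y <= d by apply/ltW; near: y; exact: lt_nbhsl.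
  have -> : g y = (g y - g c) + g c by ring.
  rewrite hE'//.
  rewrite -(@Rintegral_itvB _ _ -oo%O); [|exact: ihy|by []|by rewrite bnd_simp].
  by rewrite /F; ring.
have dFk : is_derive x 1 (F \+ cst (g c - F c)) (h x + 0).
  have dF1 : is_derive x 1 F (h x) by apply: (DeriveDef dF); rewrite -derive1E; exact: F'.
  exact: (is_deriveD dF1 (is_derive_cst _ _ _)).
split; first by apply: near_eq_derivable gF _; have [] := dFk.
rewrite derive1E -(near_eq_derive _ gF).
by have [_ ->] := dFk; rewrite addr0.
Unshelve. all: by end_near. Qed.

Lemma abs_cont_ae_derivable c d g : c <= d -> abs_cont c d g ->
  {ae mu, forall x, c < x < d -> derivable g x 1}.
Proof.
move=> cd gac; have [h [_ _]] := abs_cont_FTC cd gac.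
by apply: ae_impl => x H /H[].
Qed.

(** The form in which the fundamental theorem is used: an almost everywhere bound
    on the derivative controls the increment. *)
Lemma abs_cont_increment_le c d g (k : R -> R) (M kappa : R) : c <= d ->
  abs_cont c d g -> 0 <= M -> measurable_fun `[c, d]%classic k ->
  (\int[mu]_(x in `[c, d]) `|k x|%:E <= kappa%:E)%E ->
  {ae mu, forall x, c < x < d -> `|derive1 g x| <= `|k x| * M} ->
  `|g d - g c| <= kappa * M.
Proof.
move=> cd gac M0 mk kk gk.
have [h [ih hE hg]] := abs_cont_FTC cd gac.
rewrite hE//.
have sub : `]c, d]%classic `<=` `[c, d]%classic by apply: subset_itvr; rewrite bnd_simp.
have mo : measurable (`]c, d]%classic : set (measurableTypeR R)) by exact: measurable_itv.
have mc : measurable (`[c, d]%classic : set (measurableTypeR R)) by exact: measurable_itv.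
have iho : mu.-integrable `]c, d] (EFin \o h) by exact: (integrableS measurableT).
have X := le_normr_Rintegral mo iho.
refine (le_trans X _).
have mh : measurable_fun `]c, d] h.
  by have /measurable_int/measurable_EFinP := iho.
have ifin : (\int[mu]_(x in `]c, d]) `|h x|%:E)%E \is a fin_num.
  rewrite ge0_fin_numE; last by apply: integral_ge0 => x _; rewrite lee_fin.
  by have /integrableP[_] := iho.
have mk' : measurable_fun `]c, d]%classic k by exact: measurable_funS mk.
rewrite -lee_fin /Rintegral fineK//.
apply: (@le_trans _ _ (\int[mu]_(x in `]c, d]) (`|k x| * M)%:E)%E).
  apply: ae_ge0_le_integral => //.
  - by apply/measurable_EFinP; exact: measurableT_comp.
  - by move=> x _; rewrite lee_fin mulr_ge0.
  - apply/measurable_EFinP; apply: measurable_funM => //; exact: measurableT_comp.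
  - have ae_d : {ae mu, forall x, x <> d}.
      exists [set d]; split; [exact: measurable_set1|exact: lebesgue_measure_set1|].
      by move=> x /= /contrapT.
    apply: ae_impl2 (ae_impl2 (fun x => @conj _ _) hg gk) ae_d => x [hx kx] xd /=.
    rewrite in_itv/= => /andP[cx xled]; rewrite lee_fin.
    have cxd : c < x < d by rewrite cx lt_neqAle xled andbT; apply/eqP.
    by have [_ <-] := hx cxd; exact: kx.
under eq_integral do rewrite EFinM.
rewrite ge0_integralZr//; last first.
  by apply/measurable_EFinP; exact: measurableT_comp.
rewrite EFinM lee_wpmul2r ?lee_fin//; apply: le_trans kk.
apply: ge0_subset_integral => //.
by apply/measurable_EFinP; exact: measurableT_comp.
Qed.

Lemma abs_cont_derive0_cst c d g : c <= d -> abs_cont c d g ->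
  {ae mu, forall x, c < x < d -> derive1 g x = 0} -> g d = g c.
Proof.
move=> cd gac g0; apply/eqP; rewrite -subr_eq0 -normr_le0.
suff : `|g d - g c| <= 0 * 0 by rewrite mulr0.
apply: (@abs_cont_increment_le c d g (fun=> 0)) => //.
  by rewrite integral0_eq// => x _; rewrite normr0.
by apply: ae_impl g0 => x H /H->; rewrite normr0 mul0r.
Qed.

End ac_ftc.

(** * Locally constant functions on an interval *)

Section local_constancy.
Context {R : realType}.

(** A function that takes a single value at the points of [D] near each point of
    the interval [J] takes a single value on all of [D] in [J]. The set [D] must
    meet every subinterval, but need not contain the points around which
    constancy is assumed: interface points are allowed in [J]. *)
Lemma locally_cst_is_cst (T : Type) (J D : set R) (g : R -> T) :
  is_interval J ->
  (forall s t, J s -> J t -> s < t -> exists2 y, D y & s < y < t) ->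
  (forall s, J s -> exists2 e : R, 0 < e & exists k : T,
     forall t, J t -> D t -> `|t - s| < e -> g t = k) ->
  forall s t, J s -> D s -> J t -> D t -> g s = g t.
Proof.
move=> iJ dD lD.
suff H : forall s t, J s -> D s -> J t -> D t -> s <= t -> g s = g t.
  move=> s t Js Ds Jt Dt; have [st|/ltW ts] := leP s t; first exact: H.
  by apply/esym/H.
move=> s t Js Ds Jt Dt st.
have Jst y : s <= y <= t -> J y by move=> syt; exact: iJ Js Jt _ syt.
pose A := [set y | s <= y <= t /\ forall z, D z -> s <= z <= y -> g z = g s].
have As : A s.
  split; first by rewrite lexx.
  by move=> z _ zs; congr g; apply/le_anti; rewrite andbC.
have Aub : ubound A t by move=> y [/andP[]].
have supA : has_sup A by split; [exists s|exists t].
pose y := sup A.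
have sy : s <= y by apply: ub_le_sup => //; exists t.
have yt : y <= t by apply: ge_sup => //; exists s.
have below z : D z -> s <= z -> z < y -> g z = g s.
  move=> Dz sz zy; have /sup_adherent/(_ supA)[w Aw zw] : 0 < y - z by rewrite subr_gt0.
  have [_ ->] := Aw => //; rewrite sz/=; move: zw; rewrite -/y; lra.
have Jy : J y by apply: Jst; rewrite sy.
have [e e0 [k kP]] := lD _ Jy.
(* the local value at the supremum is the value at [s] *)
have kE : k = g s.
  have [ys|ys] := eqVneq y s.
    by rewrite -(kP s)// ys subrr normr0.
  have sy' : s < y by rewrite lt_neqAle eq_sym ys.
  have my : Num.max s (y - e / 2) < y by rewrite gt_max sy'/=; lra.
  have Jm : J (Num.max s (y - e / 2)).
    by apply: Jst; rewrite le_max lexx/= ge_max st/=; lra.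
  have [z Dz /andP[z1 z2]] := dD _ _ Jm Jy my.
  rewrite -(kP z)//.
  - apply: below => //; apply/ltW; apply: le_lt_trans z1.
    by rewrite le_max lexx.
  - apply: Jst; rewrite (le_trans (ltW z2) yt) andbT; apply/ltW; apply: le_lt_trans z1.
    by rewrite le_max lexx.
  - move: z1; rewrite gt_max => /andP[_ z1].
    by rewrite ltr0_norm; lra.
pose w := Num.min t (y + e / 2).
have Aw : A w.
  split.
    by rewrite ge_min lexx/= le_min st/=; lra.
  move=> z Dz /andP[sz]; rewrite le_min => /andP[zt zy].
  have [zye|zye] := ltP z (y - e / 2).
    by apply: below => //; lra.
  rewrite -kE; apply: kP => //; first by apply: Jst; rewrite sz.
  rewrite ltr_norml; lra.
have wy : w <= y by apply: ub_le_sup => //; exists t.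
have wt : w = t.
  move: wy; rewrite /w ge_min => /orP[ty|]; last lra.
  apply: min_l; lra.
have [_ H] := Aw; apply/esym/H => //.
by rewrite wt st lexx.
Qed.

End local_constancy.

(** * Wronskian and energy of real solutions on a segment *)

Section real_solutions.
Context {R : realType}.
Notation mu := (@lebesgue_measure R).
Implicit Types (u v V : R -> R) (D U : set R) (E p q : R).

(** [u] solves [u'' = (V - E) u] on [D]: [u] and [u'] are locally absolutely
    continuous and the equation holds almost everywhere. *)
Definition real_ode (D : set R) V E u : Prop :=
  [/\ loc_abs_cont D u, (forall t, D t -> derivable u t 1),
      loc_abs_cont D (derive1 u) &
      {ae mu, forall t, D t -> derive1 (derive1 u) t = (V t - E) * u t}].

(** The Wronskian [u v' - u' v], the determinant of the two Cauchy data. *)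
Definition wronskian u v (t : R) : R := u t * derive1 v t - derive1 u t * v t.

(** Squared norm of the Cauchy data. It vanishes exactly where both [u] and [u']
    do, and [|energy'| <= |1 + V - E| * energy]. *)
Definition energy u (t : R) : R := u t ^+ 2 + derive1 u t ^+ 2.

Lemma energy_ge0 u t : 0 <= energy u t.
Proof. by rewrite addr_ge0 ?sqr_ge0. Qed.

Lemma sqr_sum_eq0 (x y : R) : x ^+ 2 + y ^+ 2 = 0 -> x = 0 /\ y = 0.
Proof.
move=> /eqP; rewrite paddr_eq0 ?sqr_ge0// => /andP[].
by rewrite !sqrf_eq0 => /eqP-> /eqP->.
Qed.

Lemma energy_eq0 u t : energy u t = 0 -> u t = 0 /\ derive1 u t = 0.
Proof. exact: sqr_sum_eq0. Qed.

Lemma derive1MBM (f g h k : R -> R) t :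
  derivable f t 1 -> derivable g t 1 -> derivable h t 1 -> derivable k t 1 ->
  derive1 (fun s => f s * g s - h s * k s) t =
  f t * derive1 g t + g t * derive1 f t - (h t * derive1 k t + k t * derive1 h t).
Proof.
move=> df dg dh dk; rewrite !derive1E.
rewrite [LHS](deriveB (derivableM df dg) (derivableM dh dk)).
by rewrite (deriveM df dg) (deriveM dh dk).
Qed.

Lemma derive1MDM (f g h k : R -> R) t :
  derivable f t 1 -> derivable g t 1 -> derivable h t 1 -> derivable k t 1 ->
  derive1 (fun s => f s * g s + h s * k s) t =
  f t * derive1 g t + g t * derive1 f t + (h t * derive1 k t + k t * derive1 h t).
Proof.
move=> df dg dh dk; rewrite !derive1E.
rewrite [LHS](deriveD (derivableM df dg) (derivableM dh dk)).
by rewrite (deriveM df dg) (deriveM dh dk).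
Qed.

Section segment.
Variables (D : set R) (V : R -> R) (E p q : R).
Hypothesis pq : p <= q.
Hypothesis sD : `[p, q]%classic `<=` D.

Lemma segD t : p < t < q -> D t.
Proof.
by move=> /andP[pt tq]; apply: sD; rewrite /= in_itv/= !ltW.
Qed.

Lemma real_ode_ae2 u : real_ode D V E u ->
  {ae mu, forall t, p < t < q -> derivable (derive1 u) t 1 /\
     derive1 (derive1 u) t = (V t - E) * u t}.
Proof.
move=> [_ _ acu' uV]; have := abs_cont_ae_derivable pq (acu' _ _ pq sD).
by apply: ae_impl2 uV => t /= ut du ptq; split; [exact: du|exact/ut/segD].
Qed.

(** The Wronskian has derivative [u v'' - u'' v = 0] almost everywhere. *)
Lemma wronskian_segment u v : real_ode D V E u -> real_ode D V E v ->
  wronskian u v q = wronskian u v p.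
Proof.
move=> ou ov; have [acu du acu' _] := ou; have [acv dv acv' _] := ov.
apply: abs_cont_derive0_cst => //.
  apply: abs_contD; first by apply: abs_contM; [exact: acu|exact: acv'].
  by apply: abs_contN; apply: abs_contM; [exact: acu'|exact: acv].
apply: ae_impl2 (real_ode_ae2 ou) (real_ode_ae2 ov) => t uP vP ptq.
have [du2 u2E] := uP ptq; have [dv2 v2E] := vP ptq; have Dt := segD ptq.
have dut := du _ Dt; have dvt := dv _ Dt.
rewrite [LHS](derive1MBM dut dv2 du2 dvt) u2E v2E; ring.
Qed.

Lemma energy_segment_increment u (M kappa : R) : real_ode D V E u ->
  measurable_fun `[p, q]%classic V ->
  (\int[mu]_(t in `[p, q]) `|1 + V t - E|%:E <= kappa%:E)%E ->
  (forall t, p <= t <= q -> energy u t <= M) ->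
  `|energy u q - energy u p| <= kappa * M.
Proof.
move=> ou mV Vk NM; have [acu du acu' _] := ou.
have M0 : 0 <= M by apply: le_trans (NM p _); rewrite ?energy_ge0// lexx.
apply: (@abs_cont_increment_le _ _ _ _ (fun t => 1 + V t - E)) => //.
- have aM f : abs_cont p q f -> abs_cont p q (fun t => f t ^+ 2).
    by move=> fa; apply: abs_contM.
  by apply: abs_contD; apply: aM; [exact: acu|exact: acu'].
- by apply: measurable_funB => //; apply: measurable_funD.
apply: ae_impl (real_ode_ae2 ou) => t uP ptq.
have [du2 u2E] := uP ptq; have Dt := segD ptq; have dut := du _ Dt.
have -> : derive1 (energy u) t = (1 + V t - E) * (2 * (u t * derive1 u t)).
  rewrite [LHS](derive1MDM dut dut du2 du2) u2E; ring.
rewrite normrM ler_wpM2l//.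
apply: le_trans (NM t _); last by have /andP[/ltW-> /ltW->] := ptq.
rewrite /energy ler_norml.
have := sqr_ge0 (u t + derive1 u t); have := sqr_ge0 (u t - derive1 u t).
rewrite !expr2 => h1 h2; nra.
Qed.

End segment.

(** On a segment over which [|1 + V - E|] has integral at most [1/2], the energies
    at any two points are comparable: the supremum [S] of the energy exceeds each
    of its values by at most [S / 2]. This is the form of uniqueness for the
    Cauchy problem used below; no solution has to be constructed. *)
Lemma energy_segment_comparable D V E p q u : p <= q ->
  `[p, q]%classic `<=` D -> real_ode D V E u ->
  measurable_fun `[p, q]%classic V ->
  (\int[mu]_(t in `[p, q]) `|1 + V t - E|%:E <= (2^-1)%:E)%E ->
  forall s t, p <= s <= q -> p <= t <= q -> energy u t <= 2 * energy u s.
Proof.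
move=> pq sD ou mV Vk.
have [acu du acu' _] := ou.
have [M1 M10 M1P] := abs_cont_bounded (acu _ _ pq sD).
have [M2 M20 M2P] := abs_cont_bounded (acu' _ _ pq sD).
pose A := [set energy u t | t in `[p, q]%classic].
have Ap : A (energy u p) by exists p => //; rewrite /= in_itv/= lexx.
have Aub : ubound A (M1 ^+ 2 + M2 ^+ 2).
  move=> z [t tpq <-{z}]; have pt : p <= t <= q by move: tpq; rewrite /= in_itv.
  rewrite /energy.
  have sq (y K : R) : 0 < K -> `|y| <= K -> y ^+ 2 <= K ^+ 2.
    by rewrite ler_norml => K0 /andP[? ?]; nra.
  by rewrite lerD// sq// ?M1P ?M2P.
have hA : has_sup A by split; [exists (energy u p)|exists (M1 ^+ 2 + M2 ^+ 2)].
have NM t : p <= t <= q -> energy u t <= sup A.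
  by move=> pt; apply: ub_le_sup; [exact: hA.2|exists t].
(* [sup A] bounds the energy, so increments are at most half of it *)
have key y z : p <= y <= q -> p <= z <= q -> y <= z ->
    `|energy u z - energy u y| <= 2^-1 * sup A.
  move=> /andP[py yq] /andP[pz zq] yz.
  have sub : `[y, z]%classic `<=` `[p, q]%classic.
    by apply: subset_itv; rewrite bnd_simp.
  apply: (energy_segment_increment yz (subset_trans sub sD) ou).
  - exact: measurable_funS mV.
  - apply: le_trans Vk; apply: ge0_subset_integral => //.
    apply/measurable_EFinP; apply: measurableT_comp => //.
    by apply: measurable_funB => //; apply: measurable_funD.
  - move=> t /andP[yt tz]; apply: NM.
    by rewrite (le_trans py yt) (le_trans tz zq).
have key2 y z : p <= y <= q -> p <= z <= q ->
    energy u z <= energy u y + 2^-1 * sup A.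
  move=> py pz; have [yz|/ltW zy] := leP y z.
    have := key _ _ py pz yz; have := ler_norm (energy u z - energy u y); lra.
  have := key _ _ pz py zy; have := ler_norm (- (energy u y - energy u z)).
  rewrite normrN; lra.
move=> s t ps pt; apply: (le_trans (NM _ pt)).
have : sup A <= energy u s + 2^-1 * sup A.
  apply: ge_sup; first by exists (energy u p).
  by move=> y [z zpq <-{y}]; apply: key2 => //; move: zpq; rewrite /= in_itv.
lra.
Qed.

End real_solutions.

(** * Small neighbourhoods of a point *)

Section good_radius.
Context {R : realType}.
Notation mu := (@lebesgue_measure R).

Lemma oint_open (a b : \bar R) : open (oint a b).
Proof.
have open0' (A : set R) : (forall t, ~ A t) -> open A.
  by move=> A0; rewrite (_ : A = set0); [exact: open0|apply/seteqP; split].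
rewrite /oint; case: a => [a| |]; case: b => [b| |].
- rewrite (_ : [set _ | _] = `]a, b[%classic); first exact: interval_open.
  by apply/seteqP; split => t /=; rewrite in_itv/= !lte_fin.
- rewrite (_ : [set _ | _] = `]a, +oo[%classic); first exact: interval_open.
  by apply/seteqP; split => t /=; rewrite in_itv/= !lte_fin ltry.
- by apply: open0' => t /andP[].
- by apply: open0' => t /andP[].
- by apply: open0' => t /andP[].
- by apply: open0' => t /andP[].
- rewrite (_ : [set _ | _] = `]-oo, b[%classic); first exact: interval_open.
  by apply/seteqP; split => t /=; rewrite in_itv/= !lte_fin ltNyr.
- rewrite (_ : [set _ | _] = setT); first exact: openT.
  by apply/seteqP; split => t //= _; rewrite ltNyr ltry.
- by apply: open0' => t /andP[].
Qed.

Lemma oint_is_interval (a b : \bar R) : is_interval (oint a b).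
Proof.
move=> s t /andP[as' sb] /andP[at' tb] y /andP[sy yt]; apply/andP; split.
  by apply: lt_le_trans as' _; rewrite lee_fin.
by apply: le_lt_trans tb; rewrite lee_fin.
Qed.

Lemma small_integral (U : set R) (f : R -> R) s : locally_integrable U f -> U s ->
  forall eta : R, 0 < eta -> exists2 e : R, 0 < e &
    `[s - e, s + e]%classic `<=` U /\
    (\int[mu]_(t in `[(s - e)%R, (s + e)%R]) `|f t|%:E <= eta%:E)%E.
Proof.
move=> [mf oU fU] Us eta eta0.
have [e0 /= e00 He0] : nbhs s U by exact: open_nbhs_nbhs.
pose e1 := e0 / 2.
have e10 : 0 < e1 by rewrite divr_gt0.
pose K := `[s - e1, s + e1]%classic.
have KU : K `<=` U.
  move=> t; rewrite /K /= in_itv/= => /andP[h1 h2]; apply: He0 => /=.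
  have : `|s - t| <= e1 by rewrite ler_norml; lra.
  by rewrite /e1; lra.
have mK : measurable (K : set (measurableTypeR R)) by exact: measurable_itv.
have iK : mu.-integrable K (EFin \o f).
  apply/integrableP; split.
    by apply/measurable_EFinP; apply: measurable_funS mf => //; exact: open_measurable.
  by apply: fU => //; exact: segment_compact.
have iT : mu.-integrable setT (EFin \o (f \_ K)).
  by rewrite -restrict_EFin; apply/integrable_restrict => //; rewrite setTI.
have [delta [d0 Hd]] := integral_normr_continuous iT eta0.
pose e := Num.min e1 (delta / 4).
have e_gt0 : 0 < e by rewrite lt_min e10 divr_gt0.
have ee1 : e <= e1 by rewrite ge_min lexx.
have ed : e <= delta / 4 by rewrite ge_min lexx orbT.
have sub : `[s - e, s + e]%classic `<=` K.
  by apply: subset_itv; rewrite bnd_simp; lra.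
exists e => //; split; first exact: subset_trans sub KU.
have me : measurable (`[s - e, s + e]%classic : set (measurableTypeR R)).
  exact: measurable_itv.
have lt : (mu `[(s - e)%R, (s + e)%R]%classic < delta%:E)%E.
  rewrite lebesgue_measure_itv/= lte_fin; case: ifP => _.
    by rewrite -EFinB lte_fin; lra.
  by rewrite lte_fin.
have := Hd _ me lt.
have ie : mu.-integrable `[s - e, s + e] (EFin \o f) by exact: (integrableS mK).
have ifin : (\int[mu]_(x in `[(s - e)%R, (s + e)%R]) `|f x|%:E)%E \is a fin_num.
  rewrite ge0_fin_numE; last by apply: integral_ge0 => x _; rewrite lee_fin.
  by have /integrableP[_] := ie.
have -> : \int[mu]_(t in `[s - e, s + e]) `|(f \_ K) t| =
   \int[mu]_(t in `[s - e, s + e]) `|f t|.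
  apply: eq_Rintegral => t; rewrite inE => te; rewrite patchE mem_set//.
  exact: sub.
by rewrite -lte_fin /Rintegral fineK// => /ltW.
Qed.

(** Every point has a radius within which it is the only possible interface
    point and within which [energy_segment_comparable] applies. *)
Lemma good_radius (a b : \bar R) (V : R -> R) (M : set R) E s :
  locally_integrable (oint a b) V ->
  (forall c, oint a b c -> ~ limit_point M c) -> oint a b s ->
  exists2 e : R, 0 < e & [/\ forall t, `|t - s| < e -> oint a b t,
    forall t, M t -> `|t - s| < e -> t = s &
    forall p q, s - e < p -> p <= q -> q < s + e ->
     measurable_fun `[p, q]%classic V /\
     (\int[mu]_(t in `[p, q]) `|1 + V t - E|%:E <= (2^-1)%:E)%E].
Proof.
move=> hV hM Us.
have hk : locally_integrable (oint a b) (fun t => 1 + V t - E).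
  have lc k : locally_integrable (oint a b) (cst k : R -> R).
    split => //; first exact: oint_open.
    move=> K _ cK; 
    rewrite [X in (X < _)%E](_ : _ = \int[mu]_(x in K) cst `|k|%:E x)%E//.
    rewrite integral_cst; last exact: compact_measurable.
    by rewrite lte_mul_pinfty//; exact: compact_finite_measure.
  have := locally_integrableB (locally_integrableD (lc 1) hV) (lc E).
  by apply.
have [e1 e10 [sub1 int1]] : exists2 e : R, 0 < e &
    `[s - e, s + e]%classic `<=` oint a b /\
    (\int[mu]_(t in `[(s - e)%R, (s + e)%R]) `|1 + V t - E|%:E <= (2^-1)%:E)%E.
  by apply: small_integral => //; rewrite invr_gt0.
have [e2 e20 HM] : exists2 e : R, 0 < e & forall t, M t -> `|t - s| < e -> t = s.
  have /existsNP[W /not_implyP[[e /= e0 eW] nW]] := hM _ Us.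
  exists e => // t Mt ts; apply: contrapT => /eqP tns.
  by apply: nW; exists t; split => //; apply: eW; rewrite /= distrC.
exists (Num.min e1 e2); first by rewrite lt_min e10.
split.
- move=> t; rewrite lt_min => /andP[t1 _]; apply: sub1; rewrite /= in_itv/=.
  by move: t1; rewrite ltr_norml; lra.
- by move=> t Mt; rewrite lt_min => /andP[_ t2]; exact: HM.
- move=> p q sp pq qs.
  have m1 : Num.min e1 e2 <= e1 by rewrite ge_min lexx.
  have sub : `[p, q]%classic `<=` `[s - e1, s + e1]%classic.
    by apply: subset_itv; rewrite bnd_simp; lra.
  have [mV _ _] := hV; have [mk _ _] := hk.
  have subU := subset_trans sub sub1.
  have oU : measurable (oint a b) by apply: open_measurable; exact: oint_open.
  split; first exact: measurable_funS mV.
  apply: le_trans int1; apply: ge0_subset_integral => //.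
  apply/measurable_EFinP; apply: measurableT_comp => //.
  exact: measurable_funS mk.
Qed.

End good_radius.

(** * Crossing an interface point *)

Section propagation.
Context {R : realType}.
Notation mu := (@lebesgue_measure R).
Implicit Types (u v : R -> R) (A : 'M[R]_2).

(** Interface condition at [s] with matrix [A]: the four one-sided limits exist
    and the right Cauchy data are the image of the left ones by [A]. *)
Definition real_interface A u (s : R) : Prop :=
  exists um dum up dup : R,
    [/\ u t @[t --> s^'-] --> um, derive1 u t @[t --> s^'-] --> dum,
        u t @[t --> s^'+] --> up, derive1 u t @[t --> s^'+] --> dup &
        up = A 0 0 * um + A 0 1 * dum /\ dup = A 1 0 * um + A 1 1 * dum].

Lemma energy_cvg (F : set_system R) {FF : Filter F} u (l dl : R) :
  u t @[t --> F] --> l -> derive1 u t @[t --> F] --> dl ->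
  energy u t @[t --> F] --> l ^+ 2 + dl ^+ 2.
Proof.
move=> ul dul; rewrite /energy !expr2.
by apply: cvgD; exact: cvgM.
Qed.

Lemma wronskian_cvg (F : set_system R) {FF : Filter F} u v (l dl m dm : R) :
  u t @[t --> F] --> l -> derive1 u t @[t --> F] --> dl ->
  v t @[t --> F] --> m -> derive1 v t @[t --> F] --> dm ->
  wronskian u v t @[t --> F] --> l * dm - dl * m.
Proof.
by move=> ul dul vm dvm; apply: cvgB; exact: cvgM.
Qed.

Lemma cvg_near_cst_eq (F : set_system R) {FF : ProperFilter F} (f : R -> R) (l k : R) :
  f t @[t --> F] --> l -> (\forall t \near F, f t = k) -> l = k.
Proof.
move=> fl fk; apply: (@cvg_unique _ (@Rhausdorff R) _ _ _ _ fl).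
exact: cvg_near_cst.
Qed.

Lemma cvg0_le0 (F : set_system R) {FF : ProperFilter F} (f : R -> R) (k : R) :
  f t @[t --> F] --> (0 : R) -> (\forall t \near F, k <= 2 * f t) -> k <= 0.
Proof.
move=> f0 kf; rewrite leNgt; apply/negP => k0.
have fk : \forall t \near F, f t < k / 2 by apply: (cvgr_lt 0) => //; rewrite divr_gt0.
have [t [h1 h2]] := filter_ex (filterI kf fk); lra.
Qed.

Lemma det1_cancel A (um dum : R) : A 0 0 * A 1 1 - A 0 1 * A 1 0 = 1 ->
  A 0 0 * um + A 0 1 * dum = 0 -> A 1 0 * um + A 1 1 * dum = 0 ->
  um = 0 /\ dum = 0.
Proof.
move=> dA h1 h2; split.
  transitivity (A 1 1 * (A 0 0 * um + A 0 1 * dum) - A 0 1 * (A 1 0 * um + A 1 1 * dum)).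
    by rewrite -[LHS]mul1r -dA; ring.
  by rewrite h1 h2 !mulr0 subrr.
transitivity (A 0 0 * (A 1 0 * um + A 1 1 * dum) - A 1 0 * (A 0 0 * um + A 0 1 * dum)).
  by rewrite -[LHS]mul1r -dA; ring.
by rewrite h1 h2 !mulr0 subrr.
Qed.

Section nbhd.
Variables (U M : set R) (V : R -> R) (E s e : R).
Let D := U `\` M.
Hypothesis e0 : 0 < e.
Hypothesis eU : forall t, `|t - s| < e -> U t.
Hypothesis eM : forall t, M t -> `|t - s| < e -> t = s.
Hypothesis eV : forall p q, s - e < p -> p <= q -> q < s + e ->
  measurable_fun `[p, q]%classic V /\
  (\int[mu]_(t in `[p, q]) `|1 + V t - E|%:E <= (2^-1)%:E)%E.

Lemma side_subset p q : s - e < p -> q < s + e ->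
  q < s \/ s < p \/ ~ M s -> `[p, q]%classic `<=` D.
Proof.
move=> sp qs side t /=; rewrite in_itv/= => /andP[pt tq].
have te : `|t - s| < e by rewrite ltr_norml; lra.
split; first exact: eU.
move=> Mt; have ts := eM Mt te.
have [h|[h|h]] := side; [lra|lra|].
by apply: h; rewrite -ts.
Qed.

Lemma side_energy u p q : real_ode D V E u -> s - e < p -> p <= q -> q < s + e ->
  q < s \/ s < p \/ ~ M s ->
  energy u p <= 2 * energy u q /\ energy u q <= 2 * energy u p.
Proof.
move=> ou sp pq qs side; have [mV Vk] := eV sp pq qs.
have H := energy_segment_comparable pq (side_subset sp qs side) ou mV Vk.
by split; apply: H; rewrite ?lexx ?pq.
Qed.

Lemma near_left : \forall t \near s^'-, s - e < t < s.
Proof.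
near=> t; apply/andP; split; near: t.
  by apply: nbhs_left_gt; rewrite ltrBlDr ltrDl.
exact: nbhs_left_lt.
Unshelve. all: by end_near. Qed.

Lemma near_right : \forall t \near s^'+, s < t < s + e.
Proof.
near=> t; apply/andP; split; near: t.
  exact: nbhs_right_gt.
by apply: nbhs_right_lt; rewrite ltrDl.
Unshelve. all: by end_near. Qed.

(** The left limits of [u] and [u'] at [s] vanish exactly when the energy is zero
    on the left of [s]. *)
Lemma energy_left0 u um dum : real_ode D V E u ->
  u t @[t --> s^'-] --> um -> derive1 u t @[t --> s^'-] --> dum ->
  (um = 0 /\ dum = 0) <-> (forall t, s - e < t < s -> energy u t = 0).
Proof.
move=> ou ul dul.
have El : energy u t @[t --> s^'-] --> um ^+ 2 + dum ^+ 2 by exact: energy_cvg.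
split.
  move=> [um0 dum0] t /andP[st ts]; apply/le_anti; rewrite energy_ge0 andbT.
  apply: (cvg0_le0 (F := s^'-) (f := energy u)).
    by move: El; rewrite um0 dum0 expr0n/= addr0.
  near=> t'; have : s - e < t' < s by near: t'; exact: near_left.
  move=> /andP[h1 h2].
  have tt' : t <= t' by apply/ltW; near: t'; exact: nbhs_left_gt.
  by have [] := @side_energy u t t' ou st tt'; [lra|left|].
move=> H; apply: sqr_sum_eq0; apply: (cvg_near_cst_eq El).
by apply: filterS near_left => t; exact: H.
Unshelve. all: by end_near. Qed.

Lemma energy_right0 u up dup : real_ode D V E u ->
  u t @[t --> s^'+] --> up -> derive1 u t @[t --> s^'+] --> dup ->
  (up = 0 /\ dup = 0) <-> (forall t, s < t < s + e -> energy u t = 0).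
Proof.
move=> ou ul dul.
have El : energy u t @[t --> s^'+] --> up ^+ 2 + dup ^+ 2 by exact: energy_cvg.
split.
  move=> [um0 dum0] t /andP[st ts]; apply/le_anti; rewrite energy_ge0 andbT.
  apply: (cvg0_le0 (F := s^'+) (f := energy u)).
    by move: El; rewrite um0 dum0 expr0n/= addr0.
  near=> t'; have : s < t' < s + e by near: t'; exact: near_right.
  move=> /andP[h1 h2].
  have tt' : t' <= t by apply/ltW; near: t'; exact: nbhs_right_lt.
  by have [] := @side_energy u t' t ou _ tt' ts; [lra|right; left|].
move=> H; apply: sqr_sum_eq0; apply: (cvg_near_cst_eq El).
by apply: filterS near_right => t; exact: H.
Unshelve. all: by end_near. Qed.

(** A zero of the energy propagates to a neighbourhood of [s], through [s] itself
    if it is an interface point since [A] is invertible. *)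
Lemma energy0_nbhd u A : real_ode D V E u ->
  A 0 0 * A 1 1 - A 0 1 * A 1 0 = 1 -> (M s -> real_interface A u s) ->
  forall y t, D y -> D t -> `|y - s| < e -> `|t - s| < e ->
  energy u y = 0 -> energy u t = 0.
Proof.
move=> ou dA iu y t [Uy nMy] [Ut nMt] ys ts Ey.
have same p q : s - e < p -> p <= q -> q < s + e -> q < s \/ s < p \/ ~ M s ->
    (energy u p = 0 <-> energy u q = 0).
  move=> h1 h2 h3 h4; have [e1 e2] := side_energy ou h1 h2 h3 h4.
  split=> z; apply/le_anti; rewrite energy_ge0 andbT.
    by rewrite (le_trans e2)// z mulr0.
  by rewrite (le_trans e1)// z mulr0.
move: ys ts; rewrite !ltr_norml => /andP[y1 y2] /andP[t1 t2].
have y1' : s - e < y by lra. have y2' : y < s + e by lra.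
have t1' : s - e < t by lra. have t2' : t < s + e by lra.
have [Ms|nMs] := pselect (M s); last first.
  have [yt|ty] := leP y t; first by apply/(same y t) => //; right; right.
  by apply/(same t y) => //; [exact: ltW|right; right].
have ynes : y != s by apply/eqP => yE; apply: nMy; rewrite yE.
have tnes : t != s by apply/eqP => tE; apply: nMt; rewrite tE.
have [um [dum [up [dup [h1 h2 h3 h4 [h5 h6]]]]]] := iu Ms.
have L := energy_left0 ou h1 h2; have Rr := energy_right0 ou h3 h4.
(* left and right data vanish together as the matrix is invertible *)
have LR : (um = 0 /\ dum = 0) <-> (up = 0 /\ dup = 0).
  rewrite h5 h6; split => [[-> ->]|[]]; first by rewrite !mulr0 addr0.
  exact: det1_cancel.
have [ys|ys|yE] := ltgtP y s; last by rewrite yE eqxx in ynes.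
- have Z : forall t, s - e < t < s -> energy u t = 0.
    move=> z /andP[z1 z2]; have [yz|zy] := leP y z.
      by apply/(same y z) => //; [lra|left].
    by apply/(same z y) => //; [exact: ltW|left].
  have [ts|ts|tE] := ltgtP t s; last by rewrite tE eqxx in tnes.
    by apply: Z; rewrite t1'.
  by move/L/LR/Rr : Z; apply; rewrite ts.
- have Z : forall t, s < t < s + e -> energy u t = 0.
    move=> z /andP[z1 z2]; have [yz|zy] := leP y z.
      by apply/(same y z) => //; right; left.
    by apply/(same z y) => //; [lra|exact: ltW|right; left].
  have [ts|ts|tE] := ltgtP t s; last by rewrite tE eqxx in tnes.
    by move/Rr/LR/L : Z; apply; rewrite t1'.
  by apply: Z; rewrite ts.
Qed.

(** The Wronskian takes the same value on both sides of an interface point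
    because both solutions satisfy the same interface condition there and its
    matrix has determinant 1. *)
Lemma wronskian_nbhd u v A : real_ode D V E u -> real_ode D V E v ->
  A 0 0 * A 1 1 - A 0 1 * A 1 0 = 1 ->
  (M s -> real_interface A u s) -> (M s -> real_interface A v s) ->
  exists k, forall t, D t -> `|t - s| < e -> wronskian u v t = k.
Proof.
move=> ou ov dA iu iv.
have W p q : s - e < p -> p <= q -> q < s + e -> q < s \/ s < p \/ ~ M s ->
    wronskian u v q = wronskian u v p.
  by move=> h1 h2 h3 h4; apply: (wronskian_segment h2 (side_subset h1 h3 h4) ou ov).
have [Ms|nMs] := pselect (M s); last first.
  exists (wronskian u v s) => t _; rewrite ltr_norml => /andP[t1 t2].
  have [st|ts] := leP s t.
    by apply: W => //; [lra|lra|right; right].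
  by apply/esym/W => //; [lra|exact: ltW|lra|right; right].
have [um [dum [up [dup [h1 h2 h3 h4 [h5 h6]]]]]] := iu Ms.
have [vm [dvm [vp [dvp [k1 k2 k3 k4 [k5 k6]]]]]] := iv Ms.
exists (um * dvm - dum * vm) => t [Ut nMt]; rewrite ltr_norml => /andP[t1 t2].
have tnes : t != s by apply/eqP => tE; apply: nMt; rewrite tE.
have [ts|ts|tE] := ltgtP t s; last by rewrite tE eqxx in tnes.
  apply/esym/(cvg_near_cst_eq (wronskian_cvg h1 h2 k1 k2)).
  near=> z; have : s - e < z < s by near: z; exact: near_left.
  move=> /andP[z1 z2].
  by apply: W; [lra|apply/ltW; near: z; exact: nbhs_left_gt|lra|left].
have -> : um * dvm - dum * vm = up * dvp - dup * vp.
  rewrite h5 h6 k5 k6 -[LHS]mul1r -dA; ring.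
apply/esym/(cvg_near_cst_eq (wronskian_cvg h3 h4 k3 k4)).
near=> z; have : s < z < s + e by near: z; exact: near_right.
move=> /andP[z1 z2].
by apply/esym; apply: W; [lra|apply/ltW; near: z; exact: nbhs_right_lt|lra|right; left].
Unshelve. all: by end_near. Qed.

End nbhd.
End propagation.

(** * Interface matrices *)

Section interface_matrix.
Context {R : realType}.

Lemma mulmx2 (a b c d a' b' c' d' : R) :
  mx2 a b c d *m mx2 a' b' c' d' =
  mx2 (a * a' + b * c') (a * b' + b * d') (c * a' + d * c') (c * b' + d * d').
Proof.
apply/matrixP => i j; rewrite mxE big_ord_recl big_ord_recl big_ord0 addr0 !mxE /=.
by case: (i == 0); case: (j == 0).
Qed.

Lemma interface_mxE (alpha r theta : R) :
  interface_mx alpha r theta =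
  mx2 (r * cos theta + alpha * (r^-1 * sin theta))
      (- (r * sin theta) + alpha * (r^-1 * cos theta))
      (r^-1 * sin theta) (r^-1 * cos theta).
Proof. by rewrite /interface_mx !mulmx2; congr mx2; ring. Qed.

Lemma interface_mx_det (alpha r theta : R) : 0 < r ->
  let A := interface_mx alpha r theta in
  A 0 0 * A 1 1 - A 0 1 * A 1 0 = 1.
Proof.
move=> r0 /=; rewrite interface_mxE !mxE /=.
transitivity (r * r^-1 * (cos theta ^+ 2 + sin theta ^+ 2)); first ring.
by rewrite cos2Dsin2 mulr1 divff// gt_eqF.
Qed.

End interface_matrix.

(** * Propagation along the whole interval *)

Section global.
Context {R : realType}.
Variables (a b : \bar R) (V : R -> R) (I : set int) (x : I -> R) (E : R).
Hypothesis hV : locally_integrable (oint a b) V.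
Hypothesis x_in : forall n, oint a b (x n).
Hypothesis x_discrete : forall c, oint a b c -> ~ limit_point (range x) c.
Implicit Types (u v : R -> R) (A : I -> 'M[R]_2).

Let D := regular_set a b x.

(** Regular points accumulate at the right of every point of the interval. *)
Lemma regular_right_dense s t : oint a b s -> s < t ->
  exists2 y, D y & s < y < t.
Proof.
move=> Us st; have [e e0 [eU eM _]] := good_radius 0 hV x_discrete Us.
have m0 : 0 < Num.min (t - s) e by rewrite lt_min e0 subr_gt0 st.
have m1 : Num.min (t - s) e <= t - s by rewrite ge_min lexx.
have m2 : Num.min (t - s) e <= e by rewrite ge_min lexx orbT.
have ye : `|s + Num.min (t - s) e / 2 - s| < e by rewrite gtr0_norm; lra.
exists (s + Num.min (t - s) e / 2); last by apply/andP; split; lra.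
split; first exact: eU.
by move=> /eM/(_ ye); lra.
Qed.

(** Unique continuation: the truth value of [energy u t = 0] is locally constant. *)
Lemma energy0_everywhere u A : real_ode D V E u ->
  (forall n, A n 0 0 * A n 1 1 - A n 0 1 * A n 1 0 = 1) ->
  (forall n, real_interface (A n) u (x n)) ->
  forall y t, D y -> D t -> energy u y = 0 -> energy u t = 0.
Proof.
move=> ou dA iu y t Dy Dt Ey.
suff : (energy u y == 0) = (energy u t == 0) by rewrite Ey eqxx => /esym/eqP.
apply: (@locally_cst_is_cst _ _ (oint a b) D (fun t => energy u t == 0)) => //.
- exact: oint_is_interval.
- by move=> s1 s2 Us _ s12; exact: regular_right_dense.
- move=> s Us; have [e e0 [eU eM eV]] := good_radius E hV x_discrete Us.
  exists e => //.
  have [B dB iB] : exists2 B : 'M[R]_2, B 0 0 * B 1 1 - B 0 1 * B 1 0 = 1 &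
      (range x s -> real_interface B u s).
    have [[n _ <-]|nM] := pselect (range x s); first by exists (A n).
    by exists 1%:M => //; rewrite !mxE /= mulr0 subr0 mulr1.
  have H := energy0_nbhd e0 eU eM eV ou dB iB.
  have [[z [Dz ze Ez]]|nz] := pselect (exists z, [/\ D z, `|z - s| < e & energy u z = 0]).
    by exists true => w _ Dw we; apply/eqP; exact: (H z w).
  exists false => w _ Dw we; apply/negP => /eqP Ew; apply: nz.
  by exists w.
- by have [] := Dy.
- by have [] := Dt.
Qed.

Lemma energy0_of_left_limit u A n : real_ode D V E u ->
  (forall n, A n 0 0 * A n 1 1 - A n 0 1 * A n 1 0 = 1) ->
  (forall n, real_interface (A n) u (x n)) ->
  u t @[t --> (x n)^'-] --> (0 : R) -> derive1 u t @[t --> (x n)^'-] --> (0 : R) ->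
  forall t, D t -> energy u t = 0.
Proof.
move=> ou dA iu u0 du0 t Dt.
have [e e0 [eU eM eV]] := good_radius E hV x_discrete (x_in n).
have [H _] := energy_left0 e0 eU eM eV ou u0 du0.
have te : x n - e < x n - e / 2 < x n by apply/andP; split; lra.
apply: (energy0_everywhere ou dA iu _ Dt (H (conj erefl erefl) _ te)).
have ye : `|x n - e / 2 - x n| < e by rewrite ltr0_norm; lra.
split; first exact: eU.
by move=> /eM/(_ ye); lra.
Qed.

Lemma wronskian_everywhere (a' b' : \bar R) u v A :
  oint a' b' `<=` oint a b ->
  real_ode D V E u -> real_ode D V E v ->
  (forall n, A n 0 0 * A n 1 1 - A n 0 1 * A n 1 0 = 1) ->
  (forall n, oint a' b' (x n) ->
     real_interface (A n) u (x n) /\ real_interface (A n) v (x n)) ->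
  forall s t, oint a' b' s -> D s -> oint a' b' t -> D t ->
    wronskian u v s = wronskian u v t.
Proof.
move=> sub ou ov dA iuv s t.
apply: (@locally_cst_is_cst _ _ (oint a' b') D (wronskian u v)) => //.
- exact: oint_is_interval.
- by move=> s1 s2 Us _ s12; apply: regular_right_dense => //; exact: sub.
- move=> y Uy; have [e e0 [eU eM eV]] := good_radius E hV x_discrete (sub _ Uy).
  exists e => //.
  have [B [dB iu iv]] : exists B : 'M[R]_2, [/\ B 0 0 * B 1 1 - B 0 1 * B 1 0 = 1,
      (range x y -> real_interface B u y) & (range x y -> real_interface B v y)].
    have [[n _ ny]|nM] := pselect (range x y).
      by rewrite -ny in Uy *; exists (A n); split => // _; have [] := iuv n Uy.
    by exists 1%:M; split => //; rewrite !mxE /= mulr0 subr0 mulr1.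
  have [k kP] := wronskian_nbhd e0 eU eM ou ov dB iu iv.
  by exists k => w _ Dw we; exact: kP.
Qed.

End global.

(** * Square integrable real functions *)

Section real_L2.
Context {R : realType}.
Notation mu := (@lebesgue_measure R).
Implicit Types (u v g : R -> R) (S C : set R).

(** Square integrability over [S] of a real function. *)
Definition real_L2 (S : set R) u : Prop :=
  measurable_fun S u /\ (\int[mu]_(t in S) (u t ^+ 2)%:E < +oo)%E.

Lemma measurable_fun_countable S C u g : measurable S -> countable C ->
  measurable_fun S u -> (forall t, S t -> ~ C t -> g t = u t) ->
  measurable_fun S g.
Proof.
move=> mS cC mu' gu _ Y mY.
have cm (B : set R) : countable B -> measurable B by exact: countable_measurable.
have -> : S `&` g @^-1` Y = ((S `&` u @^-1` Y) `\` C) `|` (S `&` g @^-1` Y `&` C).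
  apply/seteqP; split => t /=.
    move=> [St gY]; have [Ct|nCt] := pselect (C t); first by right.
    by left; rewrite -gu.
  by move=> [[[St uY] nCt]|[[]]//]; rewrite gu.
apply: measurableU.
  by apply: measurableD; [exact: mu'|exact: cm].
by apply: cm; apply: sub_countable cC; apply: subset_card_le => t [].
Qed.

Lemma real_L2S S S' u : measurable S -> measurable S' -> S' `<=` S ->
  real_L2 S u -> real_L2 S' u.
Proof.
move=> mS mS' sub [mu' ui]; split; first exact: measurable_funS mu'.
apply: le_lt_trans ui; apply: ge0_subset_integral => //.
- by apply/measurable_EFinP; exact: measurable_funX.
- by move=> t _; rewrite lee_fin sqr_ge0.
Qed.

(** The combination is only required off a countable set, as solutions are not
    controlled at the interface points. *)
Lemma real_L2_comb S C u v g (k l : R) : measurable S -> countable C ->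
  real_L2 S u -> real_L2 S v ->
  (forall t, S t -> ~ C t -> g t = k * u t + l * v t) -> real_L2 S g.
Proof.
move=> mS cC [mu' ui] [mv vi] gE.
have mg : measurable_fun S g.
  apply: (measurable_fun_countable mS cC _ gE).
  by apply: measurable_funD; apply: measurable_funM.
split => //.
have k0 : 0 <= 2 * k ^+ 2 by rewrite mulr_ge0 ?sqr_ge0.
have l0 : 0 <= 2 * l ^+ 2 by rewrite mulr_ge0 ?sqr_ge0.
have mu2 : measurable_fun S (fun t => (u t ^+ 2)%:E).
  by apply/measurable_EFinP; exact: measurable_funX.
have mv2 : measurable_fun S (fun t => (v t ^+ 2)%:E).
  by apply/measurable_EFinP; exact: measurable_funX.
have mg2 : measurable_fun S (fun t => (g t ^+ 2)%:E).
  by apply/measurable_EFinP; exact: measurable_funX.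
apply: (@le_lt_trans _ _ (\int[mu]_(t in S)
    ((2 * k ^+ 2)%:E * (u t ^+ 2)%:E + (2 * l ^+ 2)%:E * (v t ^+ 2)%:E))%E).
  apply: ae_ge0_le_integral => //.
  - by move=> t _; rewrite lee_fin sqr_ge0.
  - by move=> t _; rewrite adde_ge0// mule_ge0// lee_fin// sqr_ge0.
  - by apply: emeasurable_funD; apply: measurable_funeM.
  - exists C; split; [exact: countable_measurable|exact: countable_lebesgue_measure0|].
    move=> t /= nH; apply: contrapT => nC; apply: nH => St.
    rewrite -!EFinM -EFinD lee_fin gE//.
    by have := sqr_ge0 (k * u t - l * v t); nra.
rewrite ge0_integralD//; last 4 first.
- by move=> t _; rewrite mule_ge0// lee_fin// sqr_ge0.
- exact: measurable_funeM.
- by move=> t _; rewrite mule_ge0// lee_fin// sqr_ge0.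
- exact: measurable_funeM.
rewrite !ge0_integralZl//; try by (move=> t _; rewrite lee_fin sqr_ge0).
by rewrite lte_add_pinfty// lte_mul_pinfty.
Qed.

Lemma sq_integrable_real_L2 S (f : R -> R[i]) : measurable S ->
  sq_integrable S f <-> real_L2 S (ReF f) /\ real_L2 S (ImF f).
Proof.
move=> mS; split.
  move=> [mr mi fi].
  have mr2 : measurable_fun S (fun t => (ReF f t ^+ 2)%:E).
    by apply/measurable_EFinP; exact: measurable_funX.
  have mi2 : measurable_fun S (fun t => (ImF f t ^+ 2)%:E).
    by apply/measurable_EFinP; exact: measurable_funX.
  have ms2 : measurable_fun S (fun t => (ReF f t ^+ 2 + ImF f t ^+ 2)%:E).
    by apply/measurable_EFinP; apply: measurable_funD; apply: measurable_funX.
  split; split => //; apply: le_lt_trans fi; apply: ge0_le_integral => //.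
  - by move=> t _; rewrite lee_fin sqr_ge0.
  - by move=> t _; rewrite lee_fin lerDl sqr_ge0.
  - by move=> t _; rewrite lee_fin sqr_ge0.
  - by move=> t _; rewrite lee_fin lerDr sqr_ge0.
move=> [[mr ri] [mi ii]]; split => //.
under eq_integral do rewrite EFinD.
rewrite ge0_integralD//; last 4 first.
- by move=> t _; rewrite lee_fin sqr_ge0.
- by apply/measurable_EFinP; exact: measurable_funX.
- by move=> t _; rewrite lee_fin sqr_ge0.
- by apply/measurable_EFinP; exact: measurable_funX.
by rewrite lte_add_pinfty.
Qed.

Lemma countable_interface_points (I : set int) (x : I -> R) : countable (range x).
Proof.
apply: (@sub_countable _ _ _ [set: I]); first exact: card_image_le.
exact: countableP.
Qed.

End real_L2.

(** * Real and imaginary parts *)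

Section complex_real.
Context {R : realType}.
Notation mu := (@lebesgue_measure R).
Variables (a b : \bar R) (V : R -> R) (I : set int) (x : I -> R).
Variables (Lambda r Theta : I -> R) (E : R).

Let D := regular_set a b x.

(** As [V] and [E] are real, real and imaginary parts solve the equation
    separately. *)
Lemma tau_real (f : R -> R[i]) t : tau V f t = E%:C * f t ->
  derive1 (derive1 (ReF f)) t = (V t - E) * ReF f t /\
  derive1 (derive1 (ImF f)) t = (V t - E) * ImF f t.
Proof.
rewrite /tau.
have -> : cderive (cderive f) t =
   derive1 (derive1 (ReF f)) t +i* derive1 (derive1 (ImF f)) t by [].
have -> : f t = ReF f t +i* ImF f t by rewrite /ReF /ImF; case: (f t).
move=> /eqP; rewrite eq_complex /= => /andP[/eqP h1 /eqP h2].

move: h1 h2; rewrite !mul0r !addr0 !subr0 => h1 h2.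
by split; rewrite mulrBl; [rewrite -h1|rewrite -h2]; ring.
Qed.

Lemma real_ode_of_complex (f : R -> R[i]) : AC1 D f ->
  {ae mu, forall t, oint a b t -> tau V f t = E%:C * f t} ->
  real_ode D V E (ReF f) /\ real_ode D V E (ImF f).
Proof.
move=> [[acr aci] df [acr' aci']] fE; split.
  split => //; first by move=> t /df[].
  by apply: ae_impl fE => t H [Ut _]; have [] := tau_real (H Ut).
split => //; first by move=> t /df[].
by apply: ae_impl fE => t H [Ut _]; have [] := tau_real (H Ut).
Qed.

Lemma real_interface_of_complex (f : R -> R[i]) :
  interface_cond x Lambda r Theta f -> forall n,
  real_interface (interface_mx (Lambda n) (r n) (Theta n)) (ReF f) (x n) /\
  real_interface (interface_mx (Lambda n) (r n) (Theta n)) (ImF f) (x n).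
Proof.
move=> fi n; have [fm [f'm [fp [f'p [[h1 i1] [h2 i2] [h3 i3] [h4 i4] eqA]]]]] := fi n.
set A := interface_mx _ _ _ in eqA *.
have e1 : fp = (A 0 0)%:C * fm + (A 0 1)%:C * f'm.
  have := congr1 (fun B : 'cV_2 => B 0 0) eqA.
  rewrite [LHS]mxE /= => ->; rewrite mxE big_ord_recl big_ord_recl big_ord0 addr0 !mxE /=.
  by have -> : lift ord0 ord0 = 1 :> 'I_2 by exact: val_inj.
have e2 : f'p = (A 1 0)%:C * fm + (A 1 1)%:C * f'm.
  have := congr1 (fun B : 'cV_2 => B 1 0) eqA.
  rewrite [LHS]mxE /= => ->; rewrite mxE big_ord_recl big_ord_recl big_ord0 addr0 !mxE /=.
  by have -> : lift ord0 ord0 = 1 :> 'I_2 by exact: val_inj.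
split.
  exists (complex.Re fm), (complex.Re f'm).
  exists (complex.Re fp), (complex.Re f'p); split => //.
  rewrite e1 e2; case: (fm) => p q; case: (f'm) => p' q' /=; split; ring.
exists (complex.Im fm), (complex.Im f'm).
  exists (complex.Im fp), (complex.Im f'p); split => //.
rewrite e1 e2; case: (fm) => p q; case: (f'm) => p' q' /=; split; ring.
Qed.

End complex_real.

(** * Wronskian of two eigenfunctions and the angle at an interface *)

Section endpoints.
Context {R : realType}.
Notation mu := (@lebesgue_measure R).
Variables (a b : \bar R) (V : R -> R) (I : set int) (x : I -> R).
Variables (Lambda r : I -> R) (psi_a psi_b E : R).
Hypothesis hV : locally_integrable (oint a b) V.
Hypothesis x_in : forall n, oint a b (x n).
Hypothesis x_discrete : forall c, oint a b c -> ~ limit_point (range x) c.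
Hypothesis r_gt0 : forall n, 0 < r n.
Implicit Types (u v g : R -> R) (Theta : I -> R).

Let D := regular_set a b x.
Let Amx Theta n := interface_mx (Lambda n) (r n) (Theta n).

(** Real solutions of the equation at energy [E], interface conditions included. *)
Definition real_solution Theta u : Prop :=
  real_ode (regular_set a b x) V E u /\
  forall n, real_interface (interface_mx (Lambda n) (r n) (Theta n)) u (x n).

(** Boundary condition with angle [psi] at the endpoint approached along [F]. *)
Definition real_bc (F : set_system R) (psi : R) u : Prop :=
  exists l dl : R, [/\ u t @[t --> F] --> l, derive1 u t @[t --> F] --> dl &
    l * cos psi + dl * sin psi = 0].

(** Real eigenfunctions for the eigenvalue [E]; nonvanishing is asked at a regular
    point, since the values at interface points carry no information. *)
Definition real_eigenfunction Theta u : Prop :=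
  [/\ real_solution Theta u, real_L2 (oint a b) u,
     (regular_left a b V x -> real_bc (fine a)^'+ psi_a u),
     (regular_right a b V x -> real_bc (fine b)^'- psi_b u) &
     exists2 t, regular_set a b x t & u t != 0].

(** Two solutions with the same boundary condition have proportional boundary
    data. *)
Lemma wronskian_bc0 (F : set_system R) {FF : ProperFilter F} psi u v (k : R) :
  real_bc F psi u -> real_bc F psi v ->
  (\forall t \near F, wronskian u v t = k) -> k = 0.
Proof.
move=> [l [dl [ul dul bu]]] [m [dm [vm dvm bv]]] Wk.
have W : wronskian u v t @[t --> F] --> l * dm - dl * m by exact: wronskian_cvg.
rewrite -(cvg_near_cst_eq W Wk).
rewrite -[LHS]mulr1 -(cos2Dsin2 psi).
transitivity
  (cos psi * ((l * cos psi + dl * sin psi) * dm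
              - dl * (m * cos psi + dm * sin psi))
   + sin psi * ((m * cos psi + dm * sin psi) * l
                - (l * cos psi + dl * sin psi) * m)); first ring.
by rewrite bu bv !(mul0r, mulr0, subr0, addr0).
Qed.

Section subinterval.
Variables (a' b' : \bar R).
Let J := oint a' b'.
Hypothesis JU : J `<=` oint a b.

(** The angles may differ outside the subinterval: only the interface conditions
    inside it matter. *)
Lemma wronskian_subinterval Theta1 Theta2 u v :
  (forall n, J (x n) -> Theta1 n = Theta2 n) ->
  real_solution Theta1 u -> real_solution Theta2 v ->
  forall s t, J s -> D s -> J t -> D t -> wronskian u v s = wronskian u v t.
Proof.
move=> Theta12 [ou iu] [ov iv].
apply: (wronskian_everywhere hV x_discrete JU ou ov (A := Amx Theta1)).
  by move=> n; exact: interface_mx_det.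
by move=> n Jn; split; [exact: iu|rewrite /Amx Theta12//; exact: iv].
Qed.

(** If [u] and [v] are square integrable solutions with nonzero Wronskian, then so
    is any solution [g]: it is the combination of [u] and [v] whose coefficients
    are the constant quotients of the Wronskians, by the identity
    [g W(u,v) = u W(g,v) - v W(g,u)]. *)
Lemma real_L2_subinterval Theta1 Theta2 Theta3 u v g s :
  (forall n, J (x n) -> Theta1 n = Theta2 n) ->
  (forall n, J (x n) -> Theta3 n = Theta1 n) ->
  real_solution Theta1 u -> real_solution Theta2 v -> real_solution Theta3 g ->
  real_L2 J u -> real_L2 J v ->
  J s -> D s -> wronskian u v s != 0 -> real_L2 J g.
Proof.
move=> T12 T31 su sv sg Lu Lv Js Ds W0.
have mJ : measurable J by apply: open_measurable; exact: oint_open.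
apply: (real_L2_comb mJ (countable_interface_points x) Lu Lv
  (k := wronskian g v s / wronskian u v s)
  (l := - (wronskian g u s / wronskian u v s))).
move=> t Jt nt; have Dt : D t by split => //; exact: JU.
have W1 := wronskian_subinterval T12 su sv Js Ds Jt Dt.
have T32 n (Jn : J (x n)) := etrans (T31 n Jn) (T12 n Jn).
have W2 := wronskian_subinterval T32 sg sv Js Ds Jt Dt.
have W3 := wronskian_subinterval T31 sg su Js Ds Jt Dt.
rewrite W2 W3 W1; rewrite W1 in W0.
apply: (mulfI W0).
rewrite mulrDr mulrA [_ / _]mulrC mulVKf// mulNr mulrN mulrA.
rewrite [wronskian g u t / _]mulrC mulVKf//.
by rewrite /wronskian; ring.
Qed.

Lemma sq_integrable_subinterval Theta1 Theta2 u v s (f : R -> R[i]) :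
  (forall n, J (x n) -> Theta1 n = Theta2 n) ->
  real_solution Theta1 u -> real_solution Theta2 v ->
  solution a b V x Lambda r Theta1 E%:C f ->
  real_L2 J u -> real_L2 J v ->
  J s -> D s -> wronskian u v s != 0 -> sq_integrable J f.
Proof.
move=> T12 su sv [acf fE fi] Lu Lv Js Ds W0.
have mJ : measurable J by apply: open_measurable; exact: oint_open.
have fE' : {ae mu, forall t, oint a b t -> tau V f t = E%:C * f t}.
  by apply: ae_impl fE => t H Ut; apply/eqP; rewrite -subr_eq0; apply/eqP; exact: H.
have [ore oim] := real_ode_of_complex acf fE'.
have ifc := real_interface_of_complex fi.
apply/sq_integrable_real_L2 => //; split.
  apply: (real_L2_subinterval T12 _ su sv _ Lu Lv Js Ds W0) => //.
  by split => // n; have [] := ifc n.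
apply: (real_L2_subinterval T12 _ su sv _ Lu Lv Js Ds W0) => //.
by split => // n; have [] := ifc n.
Qed.

End subinterval.

Lemma oint_left n : oint a (x n)%:E `<=` oint a b.
Proof.
move=> t /andP[at' tx]; apply/andP; split => //; apply: lt_trans tx _.
by have /andP[] := x_in n.
Qed.

Lemma oint_right n : oint (x n)%:E b `<=` oint a b.
Proof.
move=> t /andP[xt tb]; apply/andP; split => //; apply: lt_trans xt.
by have /andP[] := x_in n.
Qed.

Lemma not_limit_point_right (c : R) : ~ limit_point (range x) c ->
  \forall t \near c^'+, ~ range x t.
Proof.
move=> /existsNP[W /not_implyP[nW H]].
near=> t => xt; apply: H; exists t; split => //.
by near: t; apply: cvg_within.
Unshelve. all: by end_near. Qed.

Lemma not_limit_point_left (c : R) : ~ limit_point (range x) c ->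
  \forall t \near c^'-, ~ range x t.
Proof.
move=> /existsNP[W /not_implyP[nW H]].
near=> t => xt; apply: H; exists t; split => //.
by near: t; apply: cvg_within.
Unshelve. all: by end_near. Qed.

(** At a regular endpoint this follows from the boundary condition. At a limit
    point endpoint, a nonzero Wronskian would make every solution square
    integrable near the endpoint. *)
Lemma left_wronskian0 (n0 : I) Theta1 Theta2 u v :
  regular_left a b V x \/ limit_point_left a b V x Lambda r Theta1 ->
  (forall n, n != n0 -> Theta1 n = Theta2 n) ->
  real_eigenfunction Theta1 u -> real_eigenfunction Theta2 v ->
  forall t, oint a (x n0)%:E t -> D t -> wronskian u v t = 0.
Proof.
move=> hl T12 [su Lu bu _ _] [sv Lv bv _ _] t Jt Dt.
have T12' n : oint a (x n0)%:E (x n) -> Theta1 n = Theta2 n.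
  move=> /andP[_]; rewrite lte_fin => xx; apply: T12.
  by apply: contraTneq xx => ->; rewrite ltxx.
have W := wronskian_subinterval (@oint_left n0) T12' su sv.
have [rl|lp] := hl.
  have [a0 [aE _ nl]] := rl.
  have := bv rl; have := bu rl; rewrite aE /= => bu0 bv0.
  apply: (wronskian_bc0 bu0 bv0).
  have a0x : a0 < x n0.
    by have := x_in n0; rewrite /oint /= aE => /andP[]; rewrite lte_fin.
  near=> y.
  have Jy : oint a (x n0)%:E y.
    rewrite /oint /= aE !lte_fin; apply/andP; split; near: y.
      exact: nbhs_right_gt.
    exact: nbhs_right_lt.
  apply: W => //; split; first exact: (@oint_left n0).
  by near: y; exact: not_limit_point_right.
have [f sf nf] := lp E%:C.
apply/eqP; apply: contrapT => /negP W0; apply: nf.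
exists (x n0); first exact: x_in.
have mU : measurable (oint a b) by apply: open_measurable; exact: oint_open.
have mJ : measurable (oint a (x n0)%:E) by apply: open_measurable; exact: oint_open.
by apply: (sq_integrable_subinterval (@oint_left n0) T12' su sv sf
   (real_L2S mU mJ (@oint_left n0) Lu) (real_L2S mU mJ (@oint_left n0) Lv) Jt Dt W0).
Unshelve. all: by end_near. Qed.

Lemma right_wronskian0 (n0 : I) Theta1 Theta2 u v :
  regular_right a b V x \/ limit_point_right a b V x Lambda r Theta1 ->
  (forall n, n != n0 -> Theta1 n = Theta2 n) ->
  real_eigenfunction Theta1 u -> real_eigenfunction Theta2 v ->
  forall t, oint (x n0)%:E b t -> D t -> wronskian u v t = 0.
Proof.
move=> hr T12 [su Lu _ bu _] [sv Lv _ bv _] t Jt Dt.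
have T12' n : oint (x n0)%:E b (x n) -> Theta1 n = Theta2 n.
  move=> /andP[+ _]; rewrite lte_fin => xx; apply: T12.
  by apply: contraTneq xx => ->; rewrite ltxx.
have W := wronskian_subinterval (@oint_right n0) T12' su sv.
have [rl|lp] := hr.
  have [b0 [bE _ nl]] := rl.
  have := bv rl; have := bu rl; rewrite bE /= => bu0 bv0.
  apply: (wronskian_bc0 bu0 bv0).
  have a0x : x n0 < b0.
    by have := x_in n0; rewrite /oint /= bE => /andP[_]; rewrite lte_fin.
  near=> y.
  have Jy : oint (x n0)%:E b y.
    rewrite /oint /= bE !lte_fin; apply/andP; split; near: y.
      exact: nbhs_left_gt.
    exact: nbhs_left_lt.
  apply: W => //; split; first exact: (@oint_right n0).
  by near: y; exact: not_limit_point_left.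
have [f sf nf] := lp E%:C.
apply/eqP; apply: contrapT => /negP W0; apply: nf.
exists (x n0); first exact: x_in.
have mU : measurable (oint a b) by apply: open_measurable; exact: oint_open.
have mJ : measurable (oint (x n0)%:E b) by apply: open_measurable; exact: oint_open.
by apply: (sq_integrable_subinterval (@oint_right n0) T12' su sv sf
   (real_L2S mU mJ (@oint_right n0) Lu) (real_L2S mU mJ (@oint_right n0) Lv) Jt Dt W0).
Unshelve. all: by end_near. Qed.

Lemma eigenfunction_left_neq0 n Theta u (um dum : R) : real_eigenfunction Theta u ->
  u t @[t --> (x n)^'-] --> um -> derive1 u t @[t --> (x n)^'-] --> dum ->
  um ^+ 2 + dum ^+ 2 != 0.
Proof.
move=> [[ou iu] _ _ _ [t Dt ut]] hm hdm; apply/eqP => /sqr_sum_eq0[um0 dum0].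
rewrite um0 in hm; rewrite dum0 in hdm.
have := energy0_of_left_limit hV x_in x_discrete ou (A := Amx Theta) _ iu hm hdm Dt.
move=> /(_ (fun n => interface_mx_det _ _ (r_gt0 n)))/energy_eq0[u0 _].
by rewrite u0 eqxx in ut.
Qed.

(** The triangular and diagonal factors are common to [A1] and [A2] and have
    determinant 1, so only the two rotations contribute to the determinant of
    the images of [(p, q)] and [(s, t)]. *)
Lemma interface_rotation (alpha rho th1 th2 p q s t : R) : 0 < rho ->
  let A1 := interface_mx alpha rho th1 in let A2 := interface_mx alpha rho th2 in
  (A1 0 0 * p + A1 0 1 * q) * (A2 1 0 * s + A2 1 1 * t)
  - (A1 1 0 * p + A1 1 1 * q) * (A2 0 0 * s + A2 0 1 * t) =
  cos (th2 - th1) * (p * t - q * s) + sin (th2 - th1) * (p * s + q * t).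
Proof.
move=> rho0 /=; rewrite !interface_mxE !mxE /= sinB cosB.
transitivity (rho * rho^-1 *
  ((cos th2 * cos th1 + sin th2 * sin th1) * (p * t - q * s) +
   (sin th2 * cos th1 - cos th2 * sin th1) * (p * s + q * t))); first ring.
by rewrite divff ?mul1r// gt_eqF.
Qed.

(** If [E] is an eigenvalue for two angle sequences that differ only at [n0], then
    the two angles at [n0] agree modulo [pi]. The left Cauchy data of the two
    eigenfunctions are nonzero and proportional, and so are the right ones; the
    relative rotation thus fixes a real direction. *)
Lemma eigenvalue_angles (n0 : I) Theta1 Theta2 u v :
  regular_left a b V x \/ limit_point_left a b V x Lambda r Theta1 ->
  regular_right a b V x \/ limit_point_right a b V x Lambda r Theta1 ->
  (forall n, n != n0 -> Theta1 n = Theta2 n) ->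
  real_eigenfunction Theta1 u -> real_eigenfunction Theta2 v ->
  sin (Theta2 n0 - Theta1 n0) = 0.
Proof.
move=> hl hr T12 eu ev.
have WL := left_wronskian0 hl T12 eu ev.
have WR := right_wronskian0 hr T12 eu ev.
have [[_ iu] _ _ _ _] := eu; have [[_ iv] _ _ _ _] := ev.
have [um [dum [up [dup [h1 h2 h3 h4 [h5 h6]]]]]] := iu n0.
have [vm [dvm [vp [dvp [k1 k2 k3 k4 [k5 k6]]]]]] := iv n0.
have u0 := eigenfunction_left_neq0 eu h1 h2.
have v0 := eigenfunction_left_neq0 ev k1 k2.
have [e e0 [eU eM _]] := good_radius E hV x_discrete (x_in n0).
have Dy y : y != x n0 -> `|y - x n0| < e -> D y.
  move=> yx ye; split; first exact: eU.
  by move=> My; move: yx; rewrite (eM _ My ye) eqxx.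
have wl : um * dvm - dum * vm = 0.
  apply: (cvg_near_cst_eq (wronskian_cvg h1 h2 k1 k2)).
  apply: filterS (near_left (x n0) e0) => y /andP[y1 y2].
  have ye : `|y - x n0| < e by rewrite ltr_norml; lra.
  apply: WL; last by apply: Dy => //; rewrite lt_eqF.
  by have /andP[ay _] := eU _ ye; apply/andP; split.
have wr : up * dvp - dup * vp = 0.
  apply: (cvg_near_cst_eq (wronskian_cvg h3 h4 k3 k4)).
  apply: filterS (near_right (x n0) e0) => y /andP[y1 y2].
  have ye : `|y - x n0| < e by rewrite ltr_norml; lra.
  apply: WR; last by apply: Dy => //; rewrite gt_eqF.
  by have /andP[_ yb] := eU _ ye; apply/andP; split.
have := interface_rotation (Lambda n0) (Theta1 n0) (Theta2 n0) um dum vm dvm (r_gt0 n0).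
cbv zeta; rewrite -h5 -h6 -k5 -k6 wr => /esym/eqP.
rewrite wl mulr0 add0r mulf_eq0 => /orP[/eqP//|/eqP h].
(* Lagrange identity *)
have : (um ^+ 2 + dum ^+ 2) * (vm ^+ 2 + dvm ^+ 2) = 0.
  transitivity ((um * vm + dum * dvm) ^+ 2 + (um * dvm - dum * vm) ^+ 2); first ring.
  by rewrite h wl expr0n/= addr0.
by move/eqP; rewrite mulf_eq0 (negbTE u0) (negbTE v0).
Qed.

End endpoints.

(** * Eigenvalues and countability of the angles *)

Section spectrum.
Context {R : realType}.

(** One of the real and imaginary parts of an eigenfunction is nonzero at some
    regular point, because the interface points form a null set. *)
Lemma eigenvalue_real_eigenfunction (a b : \bar R) (V : R -> R) (I : set int)
    (x : I -> R) (Lambda r Theta : I -> R) (psi_a psi_b E : R) :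
  point_spectrumH a b V x Lambda r Theta psi_a psi_b E%:C ->
  exists u, real_eigenfunction a b V x Lambda r psi_a psi_b E Theta u.
Proof.
move=> [f [[L2f acf _ fi [bl br]] fn0 fE]].
have [ore oim] := real_ode_of_complex acf fE.
have ifc := real_interface_of_complex fi.
have mU : measurable (oint a b) by apply: open_measurable; exact: oint_open.
have /(sq_integrable_real_L2 _ mU)[Lre Lim] := L2f.
have bc (F : set_system R) psi : (exists fa f'a : R[i],
    [/\ clim f F fa, clim (cderive f) F f'a &
        fa * (cos psi)%:C + f'a * (sin psi)%:C = 0]) ->
    real_bc F psi (ReF f) /\ real_bc F psi (ImF f).
  move=> [[p q] [[p' q'] [[h1 h2] [h3 h4] /eqP]]].
  rewrite eq_complex /= => /andP[/eqP k1 /eqP k2]; split.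
    by exists p, p'; split => //; rewrite -[RHS]k1; ring.
  by exists q, q'; split => //; rewrite -[RHS]k2; ring.
have [t [Dt ft]] : exists t, regular_set a b x t /\ f t != 0.
  apply: contrapT => H; apply: fn0; exists (range x); split.
  - exact: countable_measurable (countable_interface_points x).
  - exact: countable_lebesgue_measure0 (countable_interface_points x).
  - move=> t /= nt; apply: contrapT => tM; apply: nt => Ut.
    by apply: contrapT => /eqP ft; apply: H; exists t.
have [re0|re0] := eqVneq (ReF f t) 0; last first.
  exists (ReF f); split => //.
  - by split => // n; have [] := ifc n.
  - by move=> /bl/bc[].
  - by move=> /br/bc[].
  - by exists t.
exists (ImF f); split => //.
- by split => // n; have [] := ifc n.
- by move=> /bl/bc[].
- by move=> /br/bc[].
- exists t => //; apply: contraNN ft => /eqP im0.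
  by rewrite eq_complex -/(ReF f t) -/(ImF f t) re0 im0 !eqxx.
Qed.

(** Two such points at distance less than [pi] are equal, so [floor (t / pi)] is
    injective on [S]. *)
Lemma countable_sin_eq0 (S : set R) :
  (forall s t, S s -> S t -> sin (s - t) = 0) -> countable S.
Proof.
move=> S0; pose h (t : R) := Num.floor (t / pi).
apply/countable_injP.
have [f finj] : exists f : int -> nat, injective f.
  by exists (@choice.pickle _); exact: (pcan_inj choice.pickleK).
exists (f \o h) => s t /set_mem Ss /set_mem St /finj hst.
have pi0 := @pi_gt0 R.
have gen s' t' : S s' -> S t' -> h s' = h t' -> s' < t' -> False.
  move=> Ss' St' hh lt; have := S0 _ _ St' Ss'.
  have d : 0 < t' - s' < pi.
    rewrite subr_gt0 lt/=.
    have h1 := Num.Theory.floor_le (s' / pi).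
    have h2 := Num.Theory.lt_succ_floor (t' / pi).
    rewrite -/(h s') hh in h1; rewrite -/(h t') in h2.
    rewrite ler_pdivlMr// in h1; rewrite ltr_pdivrMr// in h2.
    have h3 : ((h t' + 1)%:~R : R) * pi = (h t')%:~R * pi + pi.
      by rewrite intrD mulrDl mul1r.
    by rewrite h3 in h2; lra.
  by apply/eqP; rewrite gt_eqF// sin_gt0_pi.
have [lt|lt|//] := ltgtP s t; first by have := gen _ _ Ss St hst lt.
by have := gen _ _ St Ss (esym hst) lt.
Qed.

End spectrum.

(** * Resampling one coordinate of a product measure *)

Section resampling.
Context {R : realType} (I : set int).
Implicit Types (q : I -> probability (measurableTypeR R) R).

(** The sequence [p.1] with its coordinate [n0] replaced by [p.2]. *)
Definition update (n0 : I) (p : Omega3 R I * measurableTypeR R) : Omega3 R I :=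
  fun n => if n == n0 then p.2 else p.1 n.

Lemma cylinder_measurable (J : {fset I}) (A : I -> set R) :
  (forall n, measurable (A n)) -> measurable (cylinder J A : set (Omega3 R I)).
Proof. by move=> mA; apply: sub_gen_smallest; exists J, A. Qed.

Lemma setI_closed_cylinders : setI_closed (@cylinders R I).
Proof.
move=> _ _ [J [A [mA ->]]] [J' [A' [mA' ->]]].
exists (J `|` J')%fset,
  (fun n => (if n \in J then A n else setT) `&` (if n \in J' then A' n else setT)).
split.
  by move=> n; apply: measurableI; case: ifP => _ //; exact: measurableT.
apply/seteqP; split => Th /=.
  by move=> [h h'] n _; split; case: ifP => // nJ; [exact: h|exact: h'].
move=> h; split => n nJ.
  by have [] := h n; rewrite ?inE ?nJ//.
by have [] := h n; rewrite ?inE ?nJ ?orbT//.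
Qed.

Lemma update_cylinder (n0 : I) (J : {fset I}) (A : I -> set R) :
  update n0 @^-1` cylinder J A =
  cylinder (J `\ n0)%fset A `*` (if n0 \in J then A n0 else setT).
Proof.
apply/seteqP; split => -[Th th] /=.
  move=> h; split.
    move=> n; rewrite !inE => /andP[nn0 nJ].
    by have := h n nJ; rewrite /update (negbTE nn0).
  by case: ifP => // n0J; have := h n0 n0J; rewrite /update eqxx.
move=> [h1 h2] n nJ; rewrite /update; case: eqVneq => [nE|nn0] /=.
  by rewrite -nE nJ in h2.
by apply: h1; rewrite !inE nn0.
Qed.

Lemma measurable_update (n0 : I) : measurable_fun setT (update n0).
Proof.
refine (@measurability _ _ _ (Omega3 R I) setT (update n0) (@cylinders R I) erefl _).
move=> _ [_ [J [A [mA ->]]] <-].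
rewrite setTI update_cylinder; apply: measurableX; first exact: cylinder_measurable.
by case: ifP => _; [exact: mA|exact: measurableT].
Qed.

(** Replacing the coordinate [n0] by an independent one with law [q n0] preserves
    the product measure, since both measures agree on cylinders. With
    Fubini-Tonelli, [P B] is the mean of the [q n0]-measures of the lines of [B]
    in the direction [n0]. *)
Lemma product_measure_resample q (P : probability (Omega3 R I) R) (n0 : I) :
  is_product_measure q P -> forall B, measurable B ->
  P B = (\int[P]_Th q n0 [set th | B (update n0 (Th, th))])%E.
Proof.
move=> hP B mB.
pose m : {measure set (Omega3 R I) -> \bar R} :=
  measure_function_pushforward__canonical__measure_function_Measure
    (P \x q n0)%E (measurable_update n0).
transitivity (m B); last first.
  rewrite /m /= /pushforward /product_measure1; apply: eq_integral => Th _ /=.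
  by congr (q n0 _); rewrite xsectionE.
refine (@measure_unique _ R (Omega3 R I) (@cylinders R I) (fun=> setT) erefl
  _ _ _ P m _ _ B mB).
- exact: setI_closed_cylinders.
- by move=> _; exists fset0, (fun=> setT); split => //; apply/seteqP; split.
- by rewrite bigcup_const//; exists 0%N.
- move=> _ [J [A [mA ->]]].
  transitivity (\prod_(n <- J) q n (A n))%E; first exact: hP.
  rewrite /m /= /pushforward update_cylinder product_measure1E; last 2 first.
  + exact: cylinder_measurable.
  + by case: ifP => _; [exact: mA|exact: measurableT].
  rewrite [X in (X * _)%E](hP (J `\ n0)%fset A mA).
  case: ifPn => n0J; first by rewrite (big_fsetD1 n0)//= muleC.
  rewrite [X in (_ * X)%E](_ : _ = 1%E); last exact: probability_setT.
  by rewrite mule1 mem_fsetD1.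
- by move=> _; rewrite (le_lt_trans (probability_le1 P measurableT))// ltry.
Qed.

Lemma countable_null (q : probability (measurableTypeR R) R) (S : set R) :
  continuous_measure q -> countable S -> q.-negligible S.
Proof.
move=> cq /countable_injP[f finj].
have -> : S = \bigcup_k [set y | S y /\ f y = k].
  by apply/seteqP; split => [y Sy|y [k _ []]//]; exists (f y).
apply: negligible_bigcup => k.
have [[y [Sy fy]]|nk] := pselect (exists y, S y /\ f y = k).
  exists [set y]; split; [exact: measurable_set1|exact: cq|].
  by move=> z [Sz fz]; apply: finj; rewrite ?inE// fz.
exists set0; split; [exact: measurable0|exact: measure0|].
by move=> y [Sy fy]; apply: nk; exists y.
Qed.

End resampling.

(** * Null probability of a fixed eigenvalue *)

Theorem theorem6p2 (R : realType) (a b : \bar R) (hab : (a < b)%E)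
    (V : R -> R) (hV : locally_integrable (oint a b) V)
    (I : set int) (x : I -> R) (x_inj : injective x)
    (x_in : forall n, oint a b (x n))
    (x_discrete : forall c, oint a b c -> ~ limit_point (range x) c)
    (Lambda r : I -> R) (r_gt0 : forall n, 0 < r n)
    (psi_a psi_b : R) (hpsi_a : 0 <= psi_a < pi) (hpsi_b : 0 <= psi_b < pi)
    (h_left : forall Theta : I -> R,
       regular_left a b V x \/ limit_point_left a b V x Lambda r Theta)
    (h_right : forall Theta : I -> R,
       regular_right a b V x \/ limit_point_right a b V x Lambda r Theta)
    (q : I -> probability (measurableTypeR R) R)
    (P3 : probability (Omega3 R I) R) (hP3 : is_product_measure q P3)
    (n0 : I) (hn0 : continuous_measure (q n0))
    (E : R) (B : set (Omega3 R I)) (mB : measurable B)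
    (hB : B `<=` [set Theta : Omega3 R I |
       point_spectrumH a b V x Lambda r Theta psi_a psi_b E%:C]) :
  P3 B = 0%E.

Proof.
rewrite (product_measure_resample n0 hP3 mB).
apply: integral0_eq => Th _.
set S := [set th | _].
have mS : measurable (S : set (measurableTypeR R)).
  have mB' : measurable (update n0 @^-1` B).
    by rewrite -[X in measurable X]setTI; exact: measurable_update.
  have -> : S = xsection (update n0 @^-1` B) Th by rewrite xsectionE.
  exact: measurable_xsection.
apply/(negligibleP _ mS); apply: countable_null => //.
apply: countable_sin_eq0 => s t Ss St.
have [u eu] := eigenvalue_real_eigenfunction (hB _ St).
have [v ev] := eigenvalue_real_eigenfunction (hB _ Ss).
have agree n : n != n0 -> update n0 (Th, t) n = update n0 (Th, s) n.
  by move=> nn0; rewrite /update (negbTE nn0).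
have := eigenvalue_angles hV x_in x_discrete r_gt0
  (h_left (update n0 (Th, t))) (h_right (update n0 (Th, t))) agree eu ev.
by rewrite /update eqxx.
Qed.
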